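(* Let $\mu\ge 1$, let $(t_1,\dots,t_\mu)\in\mathbb{C}^\mu$ be a generic parameter, and let $\tilde f_q(x,q)=x^{\mu+1}+\sum_{i=1}^{\mu}t_i x^{\mu-i}q^{i+1}=\prod_{i=1}^{\mu+1}(x+s_iq)\in S=\mathbb{C}[x,q]$. Let $a=(a_1,\dots,a_\mu)\in\{1,\dots,\mu+1\}^{\mu}$ satisfy $a_i\ne a_j$ for $i\ne j$. For $k=1,\dots,\mu$ put $I_k:=\{a_1,\dots,a_k\}\subset\{1,\dots,\mu+1\}$, and define the ordered collection $\mathcal{E}_a=(E_1,\dots,E_\mu,E_{\mu+1},\dots,E_{2\mu})$ by $$E_k:=\begin{cases}\overline{F_{I_k}} & \text{if } 1\le k\le \mu,\\ \tau\overline{F_{I_{k-\mu}}} & \text{if } \mu+1\le k\le 2\mu.\end{cases}$$ Then $\mathcal{E}_a$ is a full strongly exceptional collection in the triangulated category $\mathrm{HMF}^{gr}_{S}(\tilde f_q)$.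
   Context: Generic parameter. The complex numbers $s_1,\dots,s_{\mu+1}$ (unique up to permutation, with $\sum_i s_i=0$) are determined by $t_i=I_{i+1}(s_1,\dots,s_{\mu+1})$ for $i=1,\dots,\mu$, where $I_k$ is the elementary symmetric polynomial of degree $k$; equivalently $\tilde f_q=\prod_{i=1}^{\mu+1}(x+s_iq)$. The parameter is called generic if $s_i\neq s_j$ for all $i\ne j$. Grading. Put $h:=\mu+1$. $S=\mathbb{C}[x,q]$ is $(2\mathbb{Z}/h)$-graded with $\deg x=\deg q=2/h$, so $\tilde f_q$ has degree $2$. Graded $S$-modules are $(2\mathbb{Z}/h)$-graded, and $\tau$ is the degree shift $(\tau M)_s=M_{s+2/h}$; graded free modules of finite rank are finite direct sums of modules $\tau^nS$, $n\in\mathbb{Z}$. The category $\mathrm{HMF}^{gr}_S(f)$ (for $f=\tilde f_q$). Objects are graded matrix factorizations $\overline F=(F_0\overset{f_0}{\underset{f_1}{\rightleftarrows}}F_1)$: $F_0,F_1$ are graded free $S$-modules of finite rank, $f_0:F_0\to F_1$ is a graded $S$-homomorphism of degree $0$, $f_1:F_1\to F_0$ is a graded $S$-homomorphism of degree $2$, and $f_1f_0=f\cdot\mathrm{id}_{F_0}$, $f_0f_1=f\cdot\mathrm{id}_{F_1}$. Morphisms $\overline F\to\overline{F'}$ are pairs $(\phi_0:F_0\to F_0',\ \phi_1:F_1\to F_1')$ of degree-$0$ graded homomorphisms with $\phi_1f_0=f_0'\phi_0$ and $\phi_0f_1=f_1'\phi_1$, modulo the pairs of the form $(h_1f_0+f_1'h_0,\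 f_0'h_1+h_0f_1)$ with $h_0:F_0\to F_1'$ graded of degree $-2$ and $h_1:F_1\to F_0'$ graded of degree $0$. The shift $\tau$ acts on objects and morphisms componentwise. The translation functor is $T\overline F=(F_1\overset{-f_1}{\underset{-\tau^h(f_0)}{\rightleftarrows}}\tau^hF_0)$ on objects and $T(\phi_0,\phi_1)=(\phi_1,\tau^h(\phi_0))$ on morphisms. The mapping cone of $\Phi=(\phi_0,\phi_1)$ is $$C(\Phi)=\left(F_1\oplus F_0'\overset{c_0}{\underset{c_1}{\rightleftarrows}}\tau^hF_0\oplus F_1'\right),\quad c_0=\begin{pmatrix}-f_1&0\\ \phi_1&f_0'\end{pmatrix},\quad c_1=\begin{pmatrix}-\tau^h(f_0)&0\\ \tau^h(\phi_0)&f_1'\end{pmatrix},$$ and the exact triangles are those isomorphic to $\overline F\xrightarrow{\Phi}\overline{F'}\to C(\Phi)\to T\overline F$ with the maps ${}^t(0\ \mathrm{id})$ and $(-\mathrm{id}\ 0)$. With these data $\mathrm{HMF}^{gr}_S(f)$ is a $\mathbb{C}$-linear triangulated category. Rank one objects. For $I\subseteq\{1,\dots,\mu+1\}$ let $\overline{F_I}:=(S\overset{f_0}{\underset{f_1}{\rightleftarrows}}\tau^{|I|}S)$ with $f_0=\prod_{i\in I}(x+s_iq)$ and $f_1=\prod_{j\notin I}(x+s_jq)$. Exceptional collections. In a $\mathbb{C}$-linear triangulated category $\mathcal{T}$ with translation $T$, an object $E$ is exceptional if $\mathrm{Hom}(E,E)=\mathbb{C}\cdot\mathrm{id}_E$ and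 $\mathrm{Hom}(E,T^pE)=0$ for $p\ne0$. A sequence $(E_1,\dots,E_l)$ of exceptional objects is an exceptional collection if $\mathrm{Hom}(E_m,T^pE_n)=0$ for all $p\in\mathbb{Z}$ and $m>n$; it is strongly exceptional if moreover $\mathrm{Hom}(E_m,T^pE_n)=0$ for all $p\neq0$ and all $m,n$; it is full if the smallest full triangulated subcategory containing all $E_i$ (closed under isomorphism) is equivalent to $\mathcal{T}$, i.e. its inclusion in $\mathcal{T}$ is an equivalence. *)

(* Defs.v *)
From HB Require Import structures.
From mathcomp Require Import all_boot all_order all_algebra.
From mathcomp Require Import boolp reals complex mpoly ring.

Set Implicit Arguments.
Unset Strict Implicit.
Unset Printing Implicit Defensive.
Import Order.TTheory GRing.Theory Num.Theory.
Local Open Scope ring_scope.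
Local Open Scope quotient_scope.

Reserved Notation "g \oc f" (at level 50, left associativity).

Record lincat (K : fieldType) := LinCat {
  obj :> Type;
  hom : obj -> obj -> lmodType K;
  idm : forall X, hom X X;
  cmp : forall X Y Z, hom Y Z -> hom X Y -> hom X Z;
  cmpA : forall W X Y Z (c : hom Y Z) (b : hom X Y) (a : hom W X),
    cmp c (cmp b a) = cmp (cmp c b) a;
  cmp1 : forall X Y (a : hom X Y), cmp (idm Y) a = a;
  cmpr1 : forall X Y (a : hom X Y), cmp a (idm X) = a;
  cmp_linl : forall X Y Z (a : hom X Y), linear (fun b : hom Y Z => cmp b a);
  cmp_linr : forall X Y Z (b : hom Y Z), linear (fun a : hom X Y => cmp b a)
}.
Arguments hom {K l}.
Arguments idm {K l}.
Arguments cmp {K l X Y Z}.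
Notation "g \oc f" := (cmp g f).

Section Categories.
Variable K : fieldType.

Definition is_iso (C : lincat K) (X Y : C) (a : hom X Y) : Prop :=
  exists b : hom Y X, b \oc a = idm X /\ a \oc b = idm Y.

Definition isomorphic (C : lincat K) (X Y : C) : Prop :=
  exists a : hom X Y, is_iso a.

Record functor (C D : lincat K) := Functor {
  fobj :> C -> D;
  fmap : forall X Y, hom X Y -> hom (fobj X) (fobj Y);
  fmap_lin : forall X Y, linear (@fmap X Y);
  fmap1 : forall X, fmap (idm X) = idm (fobj X);
  fmapM : forall X Y Z (b : hom Y Z) (a : hom X Y),
    fmap (b \oc a) = fmap b \oc fmap a
}.

Definition idF (C : lincat K) : functor C C.
Proof. by exists id (fun _ _ => id). Defined.

Definition compF (C D E : lincat K) (G : functor D E) (F : functor C D) :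
  functor C E.
Proof.
exists (fun X => G (F X)) (fun X Y a => fmap G (fmap F a)).
- by move=> X Y c a b; rewrite !fmap_lin.
- by move=> X; rewrite !fmap1.
- by move=> X Y Z b a; rewrite !fmapM.
Defined.

Definition nat_isomorphic (C D : lincat K) (F G : functor C D) : Prop :=
  exists u : forall X : C, hom (F X) (G X),
    (forall X, is_iso (u X)) /\
    (forall X Y (a : hom X Y), u Y \oc fmap F a = fmap G a \oc u X).

Definition is_equivalence (C D : lincat K) (F : functor C D) : Prop :=
  exists G : functor D C,
    nat_isomorphic (compF G F) (idF C) /\ nat_isomorphic (compF F G) (idF D).

Definition fullsub (C : lincat K) (P : C -> Prop) : lincat K.
Proof.
exists {X : C | P X} (fun X Y => hom (sval X) (sval Y))
  (fun X => idm (sval X)) (fun X Y Z b a => b \oc a).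
- by move=> *; exact: cmpA.
- by move=> *; exact: cmp1.
- by move=> *; exact: cmpr1.
- by move=> *; exact: cmp_linl.
- by move=> *; exact: cmp_linr.
Defined.

Definition inclusion (C : lincat K) (P : C -> Prop) : functor (fullsub P) C.
Proof.
by exists (fun X : fullsub P => sval X : C)
  (fun (X Y : fullsub P) (a : hom X Y) => a : hom (sval X) (sval Y)).
Defined.

(* The data of a K-linear triangulated category: translation functor (with a
   quasi-inverse, to form its negative powers) and exact triangles.  The axioms
   on exact triangles are not fields: the notions below need only the data. *)
Record tridata := TriData {
  tcat :> lincat K;
  trans : functor tcat tcat;
  itrans : functor tcat tcat;
  transK : nat_isomorphic (compF itrans trans) (idF tcat);
  itransK : nat_isomorphic (compF trans itrans) (idF tcat);
  exact_tri : forall X Y Z : tcat,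
    hom X Y -> hom Y Z -> hom Z (trans X) -> Prop
}.

Definition tpow (T : tridata) (p : int) (X : T) : T :=
  match p with
  | Posz n => iter n (trans T) X
  | Negz n => iter n.+1 (itrans T) X
  end.

(* Objects of a full triangulated subcategory closed under isomorphism. *)
Record is_trisub (T : tridata) (P : T -> Prop) : Prop := IsTriSub {
  trisub_iso : forall X Y : T, isomorphic X Y -> P X -> P Y;
  trisub_zero : forall X : T, idm X = 0 -> P X;
  trisub_trans : forall X : T, P X -> P (trans T X);
  trisub_itrans : forall X : T, P X -> P (itrans T X);
  trisub_cone : forall (X Y Z : T) (a : hom X Y) (b : hom Y Z)
      (c : hom Z (trans T X)),
    exact_tri a b c -> P X -> P Y -> P Z
}.

(* Objects of the smallest full triangulated subcategory containing the E i. *)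
Definition generated (T : tridata) (l : nat) (E : 'I_l -> T) (X : T) : Prop :=
  forall P : T -> Prop, is_trisub P -> (forall i, P (E i)) -> P X.

(* The first condition reads Hom(X, X) = K . id_X as a line, so id_X != 0. *)
Definition exceptional (T : tridata) (X : T) : Prop :=
  bijective (fun c : K => c *: idm X) /\
  (forall p : int, p != 0 -> forall a : hom X (tpow p X), a = 0).

Definition exceptional_collection (T : tridata) (l : nat) (E : 'I_l -> T) :
    Prop :=
  (forall i, exceptional (E i)) /\
  (forall (p : int) (m n : 'I_l), (n < m)%N ->
     forall a : hom (E m) (tpow p (E n)), a = 0).

Definition strongly_exceptional (T : tridata) (l : nat) (E : 'I_l -> T) :
    Prop :=
  exceptional_collection E /\
  (forall p : int, p != 0 ->
     forall (m n : 'I_l) (a : hom (E m) (tpow p (E n))), a = 0).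

Definition full_collection (T : tridata) (l : nat) (E : 'I_l -> T) : Prop :=
  is_equivalence (inclusion (generated E)).

End Categories.

Section LmodQuotient.
Variables (K : fieldType) (V : lmodType K) (N : submodClosed V).

(* N with its structure of additive subgroup. *)
Definition lsub : {pred V} := fun x => x \in N.
Lemma lsub_zmod_closed : zmod_closed lsub.
Proof.
split=> [|x y xN yN]; first exact: (rpred0 N).
rewrite -scaleN1r; apply: (rpredD (S := N)); first exact: xN.
exact: (rpredZ (s := N) (-1) yN).
Qed.
HB.instance Definition _ := GRing.isZmodClosed.Build V lsub lsub_zmod_closed.

Definition lquot := Quotient.quot lsub.
HB.instance Definition _ := GRing.Zmodule.on lquot.

Definition lquot_pi (x : V) : lquot := \pi_(Quotient.quot lsub) x.
Definition lquot_repr (x : lquot) : V := repr x.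

Lemma lquot_reprK x : lquot_pi (lquot_repr x) = x.
Proof. exact: reprK. Qed.

Lemma lquot_piP x y : lquot_pi x = lquot_pi y <-> x - y \in N.
Proof.
split=> [h|h]; last by apply/eqP; rewrite -Quotient.idealrBE.
by move/eqP: h; rewrite -Quotient.idealrBE.
Qed.

Lemma lquot_repr_pi x : lquot_repr (lquot_pi x) - x \in N.
Proof. by apply/lquot_piP; rewrite lquot_reprK. Qed.

Lemma lquot_piD x y : lquot_pi (x + y) = lquot_pi x + lquot_pi y.
Proof. by rewrite /lquot_pi raddfD. Qed.

Definition lquot_scale (c : K) (x : lquot) : lquot :=
  lquot_pi (c *: lquot_repr x).

Lemma lquot_scale_pi c x : lquot_scale c (lquot_pi x) = lquot_pi (c *: x).
Proof.
by apply/lquot_piP; rewrite -scalerBr rpredZ // lquot_repr_pi.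
Qed.

Lemma lquot_scaleA a b x :
  lquot_scale a (lquot_scale b x) = lquot_scale (a * b) x.
Proof. by rewrite -[x]lquot_reprK !lquot_scale_pi scalerA. Qed.

Lemma lquot_scale1 : left_id 1 lquot_scale.
Proof. by move=> x; rewrite -[x]lquot_reprK lquot_scale_pi scale1r. Qed.

Lemma lquot_scaleDr : right_distributive lquot_scale +%R.
Proof.
move=> c x y; rewrite -[x]lquot_reprK -[y]lquot_reprK.
by rewrite -lquot_piD !lquot_scale_pi scalerDr lquot_piD.
Qed.

Lemma lquot_scaleDl x : {morph lquot_scale^~ x : a b / a + b}.
Proof.
by move=> a b; rewrite -[x]lquot_reprK !lquot_scale_pi scalerDl lquot_piD.
Qed.

HB.instance Definition _ := GRing.Zmodule_isLmodule.Build K lquot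
  lquot_scaleA lquot_scale1 lquot_scaleDr lquot_scaleDl.

Lemma lquot_pi_lin : linear lquot_pi.
Proof. by move=> c x y; rewrite lquot_piD -lquot_scale_pi. Qed.
HB.instance Definition _ :=
  GRing.isLinear.Build K V lquot *:%R lquot_pi lquot_pi_lin.

End LmodQuotient.

Section GradedModules.
Variable K : fieldType.
Local Notation S := {mpoly K[2]}.

(* Degrees in 2Z/h are written in units of 2/h: the integer d stands for 2d/h,
   so x and q have degree 1, and degree 2 is written h. *)
Definition homogz (d : int) (p : S) : bool :=
  match d with
  | Posz n => p \is n.-homog
  | Negz _ => p == 0
  end.

(* The graded free module \bigoplus_i tau^(shifts i) S, whose elements are
   column vectors over S; an S-linear map is a matrix acting on the left. *)
Record gfree := GFree { rk : nat; shifts : 'rV[int]_rk }.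

(* Vectors in the graded piece of degree k; (tau^n S)_k = S_(k + n). *)
Definition gpiece (F : gfree) (k : int) (v : 'cV[S]_(rk F)) : Prop :=
  forall i, homogz (k + shifts F 0 i) (v i 0).

Definition ghom (F G : gfree) (d : int) (M : 'M[S]_(rk G, rk F)) : Prop :=
  forall k v, gpiece k v -> @gpiece G (k + d) (M *m v).

Definition gtau (n : int) (F : gfree) : gfree :=
  GFree (shifts F + const_mx n).

Definition gsum (F G : gfree) : gfree := GFree (row_mx (shifts F) (shifts G)).

Lemma homogz0 d : homogz d 0.
Proof. by case: d => n /=; rewrite ?rpred0. Qed.

Lemma homogzD d p q : homogz d p -> homogz d q -> homogz d (p + q).
Proof.
case: d => n /=; first exact: rpredD.
by move=> /eqP-> /eqP->; rewrite addr0.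
Qed.

Lemma homogzN d p : homogz d p -> homogz d (- p).
Proof.
by case: d => n /=; [rewrite rpredN | move/eqP->; rewrite oppr0].
Qed.

Lemma homogzM d e p q : homogz d p -> homogz e q -> homogz (d + e) (p * q).
Proof.
case: d => m; last by move=> /= /eqP-> _; rewrite mul0r homogz0.
case: e => n; last by move=> /= _ /eqP->; rewrite mulr0 homogz0.
exact: dhomogM.
Qed.

Lemma homogz_sum d (I : finType) (p : I -> S) :
  (forall i, homogz d (p i)) -> homogz d (\sum_i p i).
Proof.
move=> hp; elim/big_ind: _ => // [|x y hx hy]; first exact: homogz0.
exact: homogzD.
Qed.

Lemma ghomP (F G : gfree) (d : int) (M : 'M[S]_(rk G, rk F)) :
  ghom d M <->
  forall i j, homogz (d + shifts G 0 i - shifts F 0 j) (M i j).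
Proof.
split=> [hM i j|hM k v hv i].
  have hj : gpiece (- shifts F 0 j) (delta_mx j 0).
    move=> l; rewrite mxE eqxx andbT; case: eqP => [->|_]; last exact: homogz0.
    by rewrite addNr /= dhomog1.
  have := hM _ _ hj i; rewrite -colE mxE; congr homogz; ring.
rewrite mxE; apply: homogz_sum => j.
have := homogzM (hM i j) (hv j).
congr homogz; ring.
Qed.

Lemma ghom0 F G d : @ghom F G d 0.
Proof. by apply/ghomP=> i j; rewrite mxE homogz0. Qed.

Lemma ghomD F G d M N : @ghom F G d M -> ghom d N -> ghom d (M + N).
Proof.
by move=> /ghomP hM /ghomP hN; apply/ghomP=> i j; rewrite mxE homogzD.
Qed.

Lemma ghomN F G d M : @ghom F G d M -> ghom d (- M).
Proof. by move=> /ghomP hM; apply/ghomP=> i j; rewrite mxE homogzN. Qed.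

Lemma ghomZ F G d (c : K) M : @ghom F G d M -> ghom d (c%:MP *: M).
Proof.
move=> /ghomP hM; apply/ghomP=> i j; rewrite mxE -[_ - _]add0r.
by apply: homogzM => //; rewrite /= -alg_mpolyC rpredZ // dhomog1.
Qed.

Lemma ghom1 F : @ghom F F 0 1%:M.
Proof. by move=> k v; rewrite mul1mx addr0. Qed.

Lemma ghomM F G H d e (N : 'M_(rk H, rk G)) (M : 'M_(rk G, rk F)) :
  ghom e N -> ghom d M -> ghom (d + e) (N *m M).
Proof. by move=> hN hM k v /hM/hN; rewrite mulmxA addrA. Qed.

Lemma ghom_tau F G (n d : int) M :
  @ghom F G d M -> @ghom (gtau n F) (gtau n G) d M.
Proof.
move=> /ghomP hM; apply/ghomP=> i j; have := hM i j; rewrite /= !mxE.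
congr homogz; ring.
Qed.

Lemma ghom_taul F G (n d : int) M :
  @ghom (gtau n F) G d M = @ghom F G (d - n) M.
Proof.
apply: propext; split=> /ghomP hM; apply/ghomP=> i j; have := hM i j;
  rewrite /= !mxE; congr homogz; ring.
Qed.

Lemma ghom_taur F G (n d : int) M :
  @ghom F (gtau n G) d M = @ghom F G (d + n) M.
Proof.
apply: propext; split=> /ghomP hM; apply/ghomP=> i j; have := hM i j;
  rewrite /= !mxE; congr homogz; ring.
Qed.

Lemma ghom_col F G H d A B :
  @ghom F G d A -> @ghom F H d B -> @ghom F (gsum G H) d (col_mx A B).
Proof.
move=> /ghomP hA /ghomP hB; apply/ghomP=> i j.
by rewrite -(splitK i); case: split => k /=;
  rewrite ?(col_mxEu, row_mxEl, col_mxEd, row_mxEr).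
Qed.

Lemma ghom_row F G H d A B :
  @ghom F H d A -> @ghom G H d B -> @ghom (gsum F G) H d (row_mx A B).
Proof.
move=> /ghomP hA /ghomP hB; apply/ghomP=> i j.
by rewrite -(splitK j); case: split => k /=; rewrite ?(row_mxEl, row_mxEr).
Qed.

Lemma ghom_block F F' G G' d A B C D :
  @ghom F G d A -> @ghom F' G d B -> @ghom F G' d C -> @ghom F' G' d D ->
  @ghom (gsum F F') (gsum G G') d (block_mx A B C D).
Proof.
by move=> hA hB hC hD; apply: ghom_col; apply: ghom_row.
Qed.

End GradedModules.

Section MatrixFactorizations.
Variables (K : fieldType) (h : nat) (f : {mpoly K[2]}).
Local Notation S := {mpoly K[2]}.

(* f1_deg: degree h in units of 2/h, that is, degree 2. *)
Record mf := MF {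
  F0 : gfree;
  F1 : gfree;
  f0 : 'M[S]_(rk F1, rk F0);
  f1 : 'M[S]_(rk F0, rk F1);
  f0_deg : @ghom K F0 F1 0 f0;
  f1_deg : @ghom K F1 F0 h f1;
  f10 : f1 *m f0 = f%:M;
  f01 : f0 *m f1 = f%:M
}.
Arguments f0_deg : clear implicits.
Arguments f1_deg : clear implicits.
Arguments f10 : clear implicits.
Arguments f01 : clear implicits.

Section Morphisms.
Variables X Y : mf.

Definition mfpair : Type :=
  ('M[S]_(rk (F0 Y), rk (F0 X)) * 'M[S]_(rk (F1 Y), rk (F1 X)))%type.
HB.instance Definition _ := GRing.Zmodule.on mfpair.

Definition mfmor_axiom (p : mfpair) : Prop :=
  [/\ ghom 0 p.1, ghom 0 p.2,
      p.2 *m f0 X = f0 Y *m p.1 & p.1 *m f1 X = f1 Y *m p.2].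

Definition is_mfmor : {pred mfpair} := fun p => `[< mfmor_axiom p >].

Lemma is_mfmor_zmod : zmod_closed is_mfmor.
Proof.
split=> [|p q /asboolP[p0 p1 p2 p3] /asboolP[q0 q1 q2 q3]]; apply/asboolP.
  split; rewrite /= ?mul0mx ?mulmx0 //; exact: ghom0.
split=> /=; first by apply: ghomD => //; apply: ghomN.
- by apply: ghomD => //; apply: ghomN.
- by rewrite mulmxBl mulmxBr p2 q2.
- by rewrite mulmxBl mulmxBr p3 q3.
Qed.
HB.instance Definition _ :=
  GRing.isZmodClosed.Build mfpair is_mfmor is_mfmor_zmod.

(* Morphisms of matrix factorizations, before passing to homotopy classes. *)
Record mfmor := MFMor { mfval : mfpair; _ : mfval \in is_mfmor }.
HB.instance Definition _ := [isSub for mfval].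
HB.instance Definition _ := [Choice of mfmor by <:].
HB.instance Definition _ := [SubChoice_isSubZmodule of mfmor by <:].

Lemma mfmorP (a : mfmor) : mfmor_axiom (mfval a).
Proof. by case: a => p /= /asboolP. Qed.

Definition mkmor (p : mfpair) (hp : mfmor_axiom p) : mfmor :=
  MFMor (introT (asboolP _) hp).

Lemma mfscale_subproof (c : K) (a : mfmor) :
  mfmor_axiom (c%:MP *: (mfval a).1, c%:MP *: (mfval a).2).
Proof.
have [a0 a1 a2 a3] := mfmorP a; split=> /=; try exact: ghomZ.
- by rewrite -scalemxAl a2 scalemxAr.
- by rewrite -scalemxAl a3 scalemxAr.
Qed.
Definition mfscale c a : mfmor := mkmor (mfscale_subproof c a).

Lemma mfscaleA b c a : mfscale b (mfscale c a) = mfscale (b * c) a.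
Proof. by apply: val_inj; rewrite /= !scalerA -mpolyCM. Qed.
Lemma mfscale1 : left_id 1 mfscale.
Proof. by case=> -[p q] hp; apply: val_inj; rewrite /= !scale1r. Qed.
Lemma mfscaleDr : right_distributive mfscale +%R.
Proof. by move=> c a b; apply: val_inj; rewrite /= !scalerDr. Qed.
Lemma mfscaleDl a : {morph mfscale^~ a : b c / b + c}.
Proof. by move=> b c; apply: val_inj; rewrite /= mpolyCD !scalerDl. Qed.
HB.instance Definition _ := GRing.Zmodule_isLmodule.Build K mfmor
  mfscaleA mfscale1 mfscaleDr mfscaleDl.

Definition null_axiom (a : mfmor) : Prop :=
  exists (h0 : 'M[S]_(rk (F1 Y), rk (F0 X)))
         (h1 : 'M[S]_(rk (F0 Y), rk (F1 X))),
    [/\ ghom (- h%:Z) h0, ghom 0 h1,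
        (mfval a).1 = h1 *m f0 X + f1 Y *m h0 &
        (mfval a).2 = f0 Y *m h1 + h0 *m f1 X].

Definition null_homotopic : {pred mfmor} := fun a => `[< null_axiom a >].

Lemma null_submod : submod_closed null_homotopic.
Proof.
split=> [|c a b /asboolP[h0 [h1 [h0P h1P a0 a1]]]
  /asboolP[k0 [k1 [k0P k1P b0 b1]]]]; apply/asboolP.
  exists 0, 0; rewrite /= !mul0mx !mulmx0 !addr0.
  by split=> //; exact: ghom0.
exists (c%:MP *: h0 + k0), (c%:MP *: h1 + k1).
split; try by apply: ghomD => //; exact: ghomZ.
- rewrite /= a0 b0 mulmxDl mulmxDr scalerDr -scalemxAl -scalemxAr.
  by rewrite addrACA.
- rewrite /= a1 b1 mulmxDl mulmxDr scalerDr -scalemxAl -scalemxAr.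
  by rewrite addrACA.
Qed.
HB.instance Definition _ :=
  GRing.isSubmodClosed.Build K mfmor null_homotopic null_submod.

Definition hmf_hom : lmodType K := lquot null_homotopic.

Definition hclass : mfmor -> hmf_hom := @lquot_pi K mfmor null_homotopic.

End Morphisms.

Lemma mfid_subproof X : @mfmor_axiom X X (1%:M, 1%:M).
Proof. by split; rewrite /= ?mul1mx ?mulmx1 //; exact: ghom1. Qed.
Definition mfid X : mfmor X X := mkmor (mfid_subproof X).

Lemma mfcomp_subproof X Y Z (b : mfmor Y Z) (a : mfmor X Y) :
  @mfmor_axiom X Z ((mfval b).1 *m (mfval a).1, (mfval b).2 *m (mfval a).2).
Proof.
have [a0 a1 a2 a3] := mfmorP a; have [b0 b1 b2 b3] := mfmorP b.
split=> /=.
- exact: ghomM b0 a0.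
- exact: ghomM b1 a1.
- by rewrite -mulmxA a2 mulmxA b2 mulmxA.
- by rewrite -mulmxA a3 mulmxA b3 mulmxA.
Qed.
Definition mfcomp X Y Z (b : mfmor Y Z) (a : mfmor X Y) : mfmor X Z :=
  mkmor (mfcomp_subproof b a).

Lemma mfcomp_linl X Y Z (a : mfmor X Y) :
  linear (fun b : mfmor Y Z => mfcomp b a).
Proof.
by move=> c b b'; apply: val_inj; rewrite /= !mulmxDl -!scalemxAl.
Qed.

Lemma mfcomp_linr X Y Z (b : mfmor Y Z) :
  linear (fun a : mfmor X Y => mfcomp b a).
Proof.
by move=> c a a'; apply: val_inj; rewrite /= !mulmxDr -!scalemxAr.
Qed.

Lemma mfcomp_nulll X Y Z (b : mfmor Y Z) (a : mfmor X Y) :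
  b \in @null_homotopic Y Z -> mfcomp b a \in @null_homotopic X Z.
Proof.
move=> /asboolP[h0 [h1 [h0P h1P b0 b1]]].
have [a0 a1 a2 a3] := mfmorP a.
apply/asboolP; exists (h0 *m (mfval a).1), (h1 *m (mfval a).2); split.
- by have := ghomM h0P a0; rewrite add0r.
- exact: ghomM h1P a1.
- by rewrite /= b0 mulmxDl -!mulmxA a2.
- by rewrite /= b1 mulmxDl -!mulmxA a3.
Qed.

Lemma mfcomp_nullr X Y Z (b : mfmor Y Z) (a : mfmor X Y) :
  a \in @null_homotopic X Y -> mfcomp b a \in @null_homotopic X Z.
Proof.
move=> /asboolP[h0 [h1 [h0P h1P a0 a1]]].
have [b0 b1 b2 b3] := mfmorP b.
apply/asboolP; exists ((mfval b).2 *m h0), ((mfval b).1 *m h1); split.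
- by have := ghomM b1 h0P; rewrite addr0.
- exact: ghomM b0 h1P.
- by rewrite /= a0 mulmxDr !mulmxA b3.
- by rewrite /= a1 mulmxDr !mulmxA b2.
Qed.

Definition hmf_comp X Y Z (b : hmf_hom Y Z) (a : hmf_hom X Y) : hmf_hom X Z :=
  hclass (mfcomp (lquot_repr b) (lquot_repr a)).

Lemma hclassK X Y (a : hmf_hom X Y) : exists a', a = hclass a'.
Proof. by exists (lquot_repr a); rewrite /hclass lquot_reprK. Qed.

Lemma hclassP X Y (a b : mfmor X Y) :
  hclass a = hclass b <-> a - b \in @null_homotopic X Y.
Proof. exact: lquot_piP. Qed.

Lemma hclass_comp X Y Z (b : mfmor Y Z) (a : mfmor X Y) :
  hmf_comp (hclass b) (hclass a) = hclass (mfcomp b a).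
Proof.
rewrite /hmf_comp; set b' := lquot_repr _; set a' := lquot_repr _.
have bb' : b' - b \in @null_homotopic Y Z by exact: lquot_repr_pi.
have aa' : a' - a \in @null_homotopic X Y by exact: lquot_repr_pi.
apply/hclassP.
have -> : mfcomp b' a' - mfcomp b a = mfcomp (b' - b) a' + mfcomp b (a' - a).
  by apply: val_inj; rewrite /= !(mulmxBl, mulmxBr); congr pair; rewrite addrA subrK.
by apply: rpredD; [exact: mfcomp_nulll | exact: mfcomp_nullr].
Qed.

Lemma hclass_lin X Y : linear (@hclass X Y).
Proof. exact: lquot_pi_lin. Qed.

Definition hmf_cat : lincat K.
Proof.
exists mf hmf_hom (fun X => hclass (mfid X)) hmf_comp.
- move=> W X Y Z c b a.
  have [c' ->] := hclassK c; have [b' ->] := hclassK b.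
  have [a' ->] := hclassK a; rewrite !hclass_comp; congr hclass.
  by apply: val_inj; rewrite /= !mulmxA.
- move=> X Y a; have [a' ->] := hclassK a; rewrite hclass_comp; congr hclass.
  by case: a' => -[p q] hp; apply: val_inj; rewrite /= !mul1mx.
- move=> X Y a; have [a' ->] := hclassK a; rewrite hclass_comp; congr hclass.
  by case: a' => -[p q] hp; apply: val_inj; rewrite /= !mulmx1.
- move=> X Y Z a c b b'.
  have [a' ->] := hclassK a; have [b1 ->] := hclassK b.
  have [b2 ->] := hclassK b'.
  by rewrite -hclass_lin !hclass_comp mfcomp_linl hclass_lin.
- move=> X Y Z b c a a'.
  have [b' ->] := hclassK b; have [a1 ->] := hclassK a.
  have [a2 ->] := hclassK a'.
  by rewrite -hclass_lin !hclass_comp mfcomp_linr hclass_lin.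
Defined.

(* The shift tau^n; it does not change the matrices of morphisms. *)
Definition mf_tau (n : int) (X : mf) : mf :=
  @MF (gtau n (F0 X)) (gtau n (F1 X)) (f0 X) (f1 X)
    (ghom_tau (f0_deg X)) (ghom_tau (f1_deg X)) (f10 X) (f01 X).

Lemma mf_T_f0 X : @ghom K (F1 X) (gtau h (F0 X)) 0 (- f1 X).
Proof. by rewrite ghom_taur add0r; apply: ghomN; exact: f1_deg. Qed.
Lemma mf_T_f1 X : @ghom K (gtau h (F0 X)) (F1 X) h (- f0 X).
Proof. by rewrite ghom_taul subrr; apply: ghomN; exact: f0_deg. Qed.
Lemma mf_T_f10 X : (- f0 X) *m (- f1 X) = f%:M.
Proof. by rewrite mulNmx mulmxN opprK f01. Qed.
Lemma mf_T_f01 X : (- f1 X) *m (- f0 X) = f%:M.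
Proof. by rewrite mulNmx mulmxN opprK f10. Qed.

Definition mf_T (X : mf) : mf :=
  @MF (F1 X) (gtau h (F0 X)) (- f1 X) (- f0 X)
    (@mf_T_f0 X) (@mf_T_f1 X) (@mf_T_f10 X) (@mf_T_f01 X).

Lemma mf_Ti_f0 X : @ghom K (gtau (- h%:Z) (F1 X)) (F0 X) 0 (- f1 X).
Proof. by rewrite ghom_taul sub0r opprK; apply: ghomN; exact: f1_deg. Qed.
Lemma mf_Ti_f1 X : @ghom K (F0 X) (gtau (- h%:Z) (F1 X)) h (- f0 X).
Proof. by rewrite ghom_taur subrr; apply: ghomN; exact: f0_deg. Qed.

Definition mf_Ti (X : mf) : mf :=
  @MF (gtau (- h%:Z) (F1 X)) (F0 X) (- f1 X) (- f0 X)
    (@mf_Ti_f0 X) (@mf_Ti_f1 X) (@mf_T_f10 X) (@mf_T_f01 X).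

Lemma mf_Tmap_subproof X Y (a : mfmor X Y) :
  @mfmor_axiom (mf_T X) (mf_T Y) ((mfval a).2, (mfval a).1).
Proof.
have [a0 a1 a2 a3] := mfmorP a; split=> //=.
- exact: ghom_tau.
- by rewrite mulmxN mulNmx a3.
- by rewrite mulmxN mulNmx a2.
Qed.
Definition mf_Tmap X Y (a : mfmor X Y) : mfmor (mf_T X) (mf_T Y) :=
  mkmor (mf_Tmap_subproof a).

Lemma mf_Timap_subproof X Y (a : mfmor X Y) :
  @mfmor_axiom (mf_Ti X) (mf_Ti Y) ((mfval a).2, (mfval a).1).
Proof.
have [a0 a1 a2 a3] := mfmorP a; split=> //=.
- exact: ghom_tau.
- by rewrite mulmxN mulNmx a3.
- by rewrite mulmxN mulNmx a2.
Qed.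
Definition mf_Timap X Y (a : mfmor X Y) : mfmor (mf_Ti X) (mf_Ti Y) :=
  mkmor (mf_Timap_subproof a).

Lemma mf_Tmap_null X Y (a : mfmor X Y) : a \in @null_homotopic X Y ->
  mf_Tmap a \in @null_homotopic (mf_T X) (mf_T Y).
Proof.
move=> /asboolP[h0 [h1 [h0P h1P a0 a1]]].
apply/asboolP; exists (- h1), (- h0); split.
- by rewrite ghom_taur addNr; exact: ghomN.
- by rewrite ghom_taul add0r; exact: ghomN.
- by rewrite /= a1 !mulmxN !mulNmx !opprK addrC.
- by rewrite /= a0 !mulmxN !mulNmx !opprK addrC.
Qed.

Lemma mf_Timap_null X Y (a : mfmor X Y) : a \in @null_homotopic X Y ->
  mf_Timap a \in @null_homotopic (mf_Ti X) (mf_Ti Y).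
Proof.
move=> /asboolP[h0 [h1 [h0P h1P a0 a1]]].
apply/asboolP; exists (- h1), (- h0); split.
- by rewrite ghom_taul opprK addNr; exact: ghomN.
- by rewrite ghom_taur add0r; exact: ghomN.
- by rewrite /= a1 !mulmxN !mulNmx !opprK addrC.
- by rewrite /= a0 !mulmxN !mulNmx !opprK addrC.
Qed.

Definition hmf_Tmap X Y (a : hmf_hom X Y) : hmf_hom (mf_T X) (mf_T Y) :=
  hclass (mf_Tmap (lquot_repr a)).
Definition hmf_Timap X Y (a : hmf_hom X Y) : hmf_hom (mf_Ti X) (mf_Ti Y) :=
  hclass (mf_Timap (lquot_repr a)).

Lemma hclass_T X Y (a : mfmor X Y) :
  hmf_Tmap (hclass a) = hclass (mf_Tmap a).
Proof.
apply/hclassP; have -> : mf_Tmap (lquot_repr (hclass a)) - mf_Tmap a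
  = mf_Tmap (lquot_repr (hclass a) - a) by exact: val_inj.
by apply: mf_Tmap_null; exact: lquot_repr_pi.
Qed.

Lemma hclass_Ti X Y (a : mfmor X Y) :
  hmf_Timap (hclass a) = hclass (mf_Timap a).
Proof.
apply/hclassP; have -> : mf_Timap (lquot_repr (hclass a)) - mf_Timap a
  = mf_Timap (lquot_repr (hclass a) - a) by exact: val_inj.
by apply: mf_Timap_null; exact: lquot_repr_pi.
Qed.

Definition hmf_T : functor hmf_cat hmf_cat.
Proof.
exists mf_T hmf_Tmap.
- move=> X Y c a b; have [a' ->] := hclassK a; have [b' ->] := hclassK b.
  by rewrite -hclass_lin !hclass_T -hclass_lin; congr hclass; exact: val_inj.
- by move=> X; rewrite /= hclass_T; congr hclass; exact: val_inj.
- move=> X Y Z b a; have [a' ->] := hclassK a; have [b' ->] := hclassK b.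
  rewrite /= hclass_comp !hclass_T hclass_comp; congr hclass.
  exact: val_inj.
Defined.

Definition hmf_Ti : functor hmf_cat hmf_cat.
Proof.
exists mf_Ti hmf_Timap.
- move=> X Y c a b; have [a' ->] := hclassK a; have [b' ->] := hclassK b.
  by rewrite -hclass_lin !hclass_Ti -hclass_lin; congr hclass; exact: val_inj.
- by move=> X; rewrite /= hclass_Ti; congr hclass; exact: val_inj.
- move=> X Y Z b a; have [a' ->] := hclassK a; have [b' ->] := hclassK b.
  rewrite /= hclass_comp !hclass_Ti hclass_comp; congr hclass.
  exact: val_inj.
Defined.

Lemma mf_TiT_subproof X : @mfmor_axiom (mf_Ti (mf_T X)) X (1%:M, 1%:M).
Proof.
split=> /=; rewrite ?opprK ?mulmx1 ?mul1mx //; last exact: ghom1.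
by rewrite !ghom_taul opprK add0r subrr; exact: ghom1.
Qed.
Lemma mf_TiTV_subproof X : @mfmor_axiom X (mf_Ti (mf_T X)) (1%:M, 1%:M).
Proof.
split=> /=; rewrite ?opprK ?mulmx1 ?mul1mx //; last exact: ghom1.
by rewrite !ghom_taur add0r addNr; exact: ghom1.
Qed.
Lemma mf_TTi_subproof X : @mfmor_axiom (mf_T (mf_Ti X)) X (1%:M, 1%:M).
Proof.
split=> /=; rewrite ?opprK ?mulmx1 ?mul1mx //; first exact: ghom1.
by rewrite !ghom_taul opprK add0r addNr; exact: ghom1.
Qed.
Lemma mf_TTiV_subproof X : @mfmor_axiom X (mf_T (mf_Ti X)) (1%:M, 1%:M).
Proof.
split=> /=; rewrite ?opprK ?mulmx1 ?mul1mx //; first exact: ghom1.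
by rewrite !ghom_taur add0r subrr; exact: ghom1.
Qed.

Lemma hmf_TK : nat_isomorphic (compF hmf_Ti hmf_T) (idF hmf_cat).
Proof.
exists (fun X => hclass (mkmor (mf_TiT_subproof X))); split=> [X|X Y a] /=.
  exists (hclass (mkmor (mf_TiTV_subproof X))).
  by split; rewrite /= hclass_comp; congr hclass; apply: val_inj;
    rewrite /= !mulmx1.
have [a' ->] := hclassK a; rewrite hclass_T hclass_Ti !hclass_comp.
by congr hclass; apply: val_inj; rewrite /= !mulmx1 !mul1mx.
Qed.

Lemma hmf_TiK : nat_isomorphic (compF hmf_T hmf_Ti) (idF hmf_cat).
Proof.
exists (fun X => hclass (mkmor (mf_TTi_subproof X))); split=> [X|X Y a] /=.
  exists (hclass (mkmor (mf_TTiV_subproof X))).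
  by split; rewrite /= hclass_comp; congr hclass; apply: val_inj;
    rewrite /= !mulmx1.
have [a' ->] := hclassK a; rewrite hclass_Ti hclass_T !hclass_comp.
by congr hclass; apply: val_inj; rewrite /= !mulmx1 !mul1mx.
Qed.

Section Cone.
Variables (X Y : mf) (a : mfmor X Y).
Let C0 := gsum (F1 X) (F0 Y).
Let C1 := gsum (gtau h (F0 X)) (F1 Y).
Let c0 : 'M[S]_(rk C1, rk C0) := block_mx (- f1 X) 0 (mfval a).2 (f0 Y).
Let c1 : 'M[S]_(rk C0, rk C1) := block_mx (- f0 X) 0 (mfval a).1 (f1 Y).

Lemma cone_f0 : ghom 0 c0.
Proof.
have [a0 a1 a2 a3] := mfmorP a.
exact: (ghom_block (@mf_T_f0 X) (@ghom0 K _ _ _) a1 (f0_deg Y)).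
Qed.

Lemma cone_f1 : ghom h c1.
Proof.
have [a0 a1 a2 a3] := mfmorP a.
have a0' : @ghom K (gtau h (F0 X)) (F0 Y) h (mfval a).1.
  by rewrite ghom_taul subrr.
exact: (ghom_block (@mf_T_f1 X) (@ghom0 K _ _ _) a0' (f1_deg Y)).
Qed.

Lemma cone_f10 : c1 *m c0 = f%:M.
Proof.
have [a0 a1 a2 a3] := mfmorP a.
rewrite mulmx_block !mul0mx !mulmx0 !addr0 add0r mf_T_f10 f10.
by rewrite mulmxN a3 addNr -scalar_mx_block.
Qed.

Lemma cone_f01 : c0 *m c1 = f%:M.
Proof.
have [a0 a1 a2 a3] := mfmorP a.
rewrite mulmx_block !mul0mx !mulmx0 !addr0 add0r mf_T_f01 f01.
by rewrite mulmxN a2 addNr -scalar_mx_block.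
Qed.

Definition cone : mf := MF cone_f0 cone_f1 cone_f10 cone_f01.

Lemma cone_in_subproof : @mfmor_axiom Y cone (col_mx 0 1%:M, col_mx 0 1%:M).
Proof.
split=> /=.
- by apply: ghom_col; [exact: ghom0 | exact: ghom1].
- by apply: ghom_col; [exact: ghom0 | exact: ghom1].
- by rewrite mul_col_mx mul_block_col !mul0mx !mulmx0 mul1mx mulmx1 !add0r.
- by rewrite mul_col_mx mul_block_col !mul0mx !mulmx0 mul1mx mulmx1 !add0r.
Qed.
Definition cone_in : mfmor Y cone := mkmor cone_in_subproof.

Lemma cone_out_subproof :
  @mfmor_axiom cone (mf_T X) (row_mx (- 1%:M) 0, row_mx (- 1%:M) 0).
Proof.
split=> /=.
- by apply: ghom_row; [apply: ghomN; exact: ghom1 | exact: ghom0].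
- by apply: ghom_row; [apply: ghomN; exact: ghom1 | exact: ghom0].
- rewrite mul_row_block mul_mx_row !mul0mx !mulmx0 !addr0.
  by rewrite !mulNmx !mulmxN mul1mx mulmx1.
- rewrite mul_row_block mul_mx_row !mul0mx !mulmx0 !addr0.
  by rewrite !mulNmx !mulmxN mul1mx mulmx1.
Qed.
Definition cone_out : mfmor cone (mf_T X) := mkmor cone_out_subproof.

End Cone.

(* Triangles isomorphic to X' -> Y' -> cone p -> T X' for some p. *)
Definition hmf_exact (X Y Z : hmf_cat) (a : hom X Y) (b : hom Y Z)
    (c : hom Z (hmf_T X)) : Prop :=
  exists (X' Y' : mf) (p : mfmor X' Y')
    (u : hom X (X' : hmf_cat)) (v : hom Y (Y' : hmf_cat))
    (w : hom Z (cone p : hmf_cat)),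
    [/\ is_iso u, is_iso v & is_iso w] /\
    [/\ v \oc a = (hclass p : hom (X' : hmf_cat) Y') \oc u,
        w \oc b = (hclass (cone_in p) : hom (Y' : hmf_cat) (cone p)) \oc v &
        fmap hmf_T u \oc c
        = (hclass (cone_out p) : hom (cone p : hmf_cat) (mf_T X')) \oc w].

Definition HMF : tridata K := TriData hmf_TK hmf_TiK hmf_exact.

End MatrixFactorizations.

Section TypeA.
Variables (K : fieldType) (mu : nat).
Local Notation S := {mpoly K[2]}.

Definition x_ : S := 'X_(ord0 : 'I_2).
Definition q_ : S := 'X_(ord_max : 'I_2).

(* t i, s i and a i (i from 0) stand for t_(i+1), s_(i+1) and a_(i+1). *)
Definition ftilde (t : 'I_mu -> K) : S :=
  x_ ^+ mu.+1 + \sum_(i < mu) t i *: (x_ ^+ (mu - i.+1) * q_ ^+ i.+2).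

Definition is_param (t : 'I_mu -> K) (s : 'I_mu.+1 -> K) : Prop :=
  \sum_i s i = 0 /\
  forall i : 'I_mu, t i = (mesym mu.+1 K i.+2).@[s].

Definition linprod (s : 'I_mu.+1 -> K) (I : {set 'I_mu.+1}) : S :=
  \prod_(i in I) (x_ + s i *: q_).

Lemma linprodT s : linprod s [set: 'I_mu.+1] =
  \sum_(k < mu.+2) (mesym mu.+1 K k).@[s] *: (x_ ^+ (mu.+1 - k) * q_ ^+ k).
Proof.
rewrite /linprod; under eq_bigl do rewrite in_setT.
under eq_bigr do rewrite addrC.
rewrite bigA_distr.
have cardP (J : {set 'I_mu.+1}) : (#|J| < mu.+2)%N.
  by rewrite ltnS (leq_trans (max_card _)) ?card_ord.
rewrite (partition_big (fun J : {set 'I_mu.+1} => Ordinal (cardP J)) xpredT) //=.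
apply: eq_bigr => k _; rewrite /mesym raddf_sum scaler_suml /=.
apply: eq_big => [J|J /eqP <-] //=.
rewrite rmorph_prod /=; under [in RHS]eq_bigr do rewrite mevalXU.
rewrite (bigID (mem J)) /=.
rewrite (eq_bigr (fun i => s i *: q_)) => [|i ->] //.
rewrite [X in _ * X](eq_bigr (fun=> x_)) => [|i /negbTE ->] //.
rewrite scaler_prod !prodr_const -scalerAl mulrC; congr (_ *: (x_ ^+ _ * _)).
have -> : #|[pred i | i \notin J]| = #|~: J| by apply: eq_card => i; rewrite !inE.
by rewrite cardsCs setCK card_ord.
Qed.

Lemma ftildeE t s : is_param t s ->
  ftilde t = \prod_(i < mu.+1) (x_ + s i *: q_).
Proof.
move=> [s0 ht].
have -> : \prod_(i < mu.+1) (x_ + s i *: q_) = linprod s setT.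
  by apply: eq_bigl => i; rewrite in_setT.
rewrite linprodT !big_ord_recl /= mesym0E meval1 scale1r expr0 mulr1 subn0.
congr (_ + _); rewrite mesym1E raddf_sum /=.
under [X in X *: _]eq_bigr do rewrite mevalXU.
rewrite s0 scale0r add0r; apply: eq_bigr => i _.
by rewrite ht /= /bump !add1n subSS.
Qed.

Lemma linprod_homog s I : linprod s I \is #|I|.-homog.
Proof.
rewrite /linprod -sum1_card; elim/big_rec2: _ => [|i n p _ hp].
  exact: dhomog1.
apply: dhomogM => //; apply: rpredD; [|apply: rpredZ];
  by rewrite dhomogX; apply/eqP; exact: mdeg1.
Qed.

Section RankOne.
Variables (t : 'I_mu -> K) (s : 'I_mu.+1 -> K) (ts : is_param t s).
Variable I : {set 'I_mu.+1}.

Let G0 : gfree := GFree (0 : 'rV_1).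
Let G1 : gfree := gtau #|I| G0.

Lemma rank_one_f0 : @ghom K G0 G1 0 (linprod s I)%:M.
Proof.
apply/ghomP=> i j; rewrite /= !ord1 !mxE eqxx mulr1n subr0 !add0r.
exact: linprod_homog.
Qed.

Lemma rank_one_f1 : @ghom K G1 G0 mu.+1 (linprod s (~: I))%:M.
Proof.
apply/ghomP=> i j; rewrite /= !ord1 !mxE eqxx mulr1n addr0 add0r.
have -> : mu.+1%:Z - #|I|%:Z = #|~: I|%:Z.
  apply/eqP; rewrite subr_eq addrC -PoszD eqz_nat; apply/eqP.
  by rewrite cardsC card_ord.
exact: linprod_homog.
Qed.

Lemma linprodC : linprod s (~: I) * linprod s I = ftilde t.
Proof.
rewrite (ftildeE ts) (bigID (mem I)) /= mulrC; congr (_ * _).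
by apply: eq_bigl => i; rewrite inE.
Qed.

Lemma rank_one_f10 :
  (linprod s (~: I))%:M *m (linprod s I)%:M = (ftilde t)%:M :> 'M[S]_1.
Proof. by rewrite -scalar_mxM linprodC. Qed.

Lemma rank_one_f01 :
  (linprod s I)%:M *m (linprod s (~: I))%:M = (ftilde t)%:M :> 'M[S]_1.
Proof. by rewrite -scalar_mxM mulrC linprodC. Qed.

Definition rank_one : mf mu.+1 (ftilde t) :=
  MF rank_one_f0 rank_one_f1 rank_one_f10 rank_one_f01.

End RankOne.

Definition index_set (a : 'I_mu -> 'I_mu.+1) (k : 'I_mu) : {set 'I_mu.+1} :=
  [set a j | j : 'I_mu & (j <= k)%N].

Definition collection (t : 'I_mu -> K) (s : 'I_mu.+1 -> K)
    (ts : is_param t s) (a : 'I_mu -> 'I_mu.+1) (k : 'I_(mu + mu)) :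
    HMF mu.+1 (ftilde t) :=
  match split k with
  | inl i => rank_one ts (index_set a i)
  | inr i => mf_tau 1 (rank_one ts (index_set a i))
  end.

End TypeA.

(* Main.v *)
Require Import Defs.
From mathcomp Require Import all_boot all_order all_algebra.
From mathcomp Require Import reals complex mpoly.
From mathcomp Require Import boolp ring zify.

(** Write [l_i = x + s_i q], [h = mu + 1], [F_I] for the rank one factorization
    [(f_I, f / f_I)] with [f_I] the product of the [l_i], [i] in [I], and
    measure degrees in units of [2 / h], so that [x], [q] and the [l_i] have
    degree 1 and [tau] shifts by 1.

    Vanishing of morphisms.  Since [T^2 = tau^h], it is enough to know the
    morphisms from [tau^m F_I] to [tau^n F_J] and to [tau^n (T F_J)].  Between
    rank one objects a morphism is a pair of forms.  When [I] and [J] are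
    comparable, let [A] be the smaller of the two sets and [B] the complement of
    the larger one; [f_A] and [f_B] are coprime.  In the odd case this makes
    every morphism null-homotopic ([linprod_coprime]).  In the even case the
    morphisms modulo homotopy form one graded piece of [S / (f_A, f_B)].  This
    ring is concentrated in degrees [0, ..., |A| + |B| - 2]
    ([linprod_nullstellensatz]), and whenever strong exceptionality requires
    vanishing for two objects of the collection, the degree concerned is
    outside this range ([hom_tpow_eq0]).  In degree 0 the ring is the ground
    field, which gives the endomorphisms.

    Fullness.  Let [P] be a triangulated subcategory containing the collection.
    The engine is that a factorization [f_0 = B A] of the first matrix of [X]
    puts [X] in an exact triangle between the matrix factorizations that start
    with [A] and with [B] ([cone_left_factor_in]); hence [P] contains the third
    of them as soon as it contains two.

    - Every [X] is an iterated extension of objects [tau^n F_{i}]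
      ([trisub_all]).  If [f_0] is singular at the point [(-s_i : 1)], then
      some homogeneous column operation makes one column of [f_0] divisible by
      [l_i], which splits off one [tau^n F_{i}] and lowers a nonnegative degree
      count.  If [f_0] is singular at none of these points, then dividing
      [f_1] by all the [l_i] produces an inverse of [f_0], so that [X] is
      contractible.

    - Two consecutive terms of the chain [I_1, ..., I_mu], completed by the
      empty and the full sets whose objects are zero, differ by one element
      [i]; the engine gives [tau^k F_{i}] and [tau^(k+1) F_{i}] in [P], with [k]
      the size of the smaller set.  Each [i], and each [k < h], occurs.

    - The cone of [q : tau^n F_{i} -> tau^(n+1) F_{i}] is the stabilization of
      the residue field, and does not depend on [i] ([koszul_indep]).  By the
      previous point and [T^2 = tau^h] it lies in [P] for every [n], and then
      one twist of [F_{i}] in [P] brings all the others ([trisub_linear]). *)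

Set Implicit Arguments.
Unset Strict Implicit.
Unset Printing Implicit Defensive.
Import Order.TTheory GRing.Theory Num.Theory.
Local Open Scope ring_scope.

(** * Binary forms and products of linear forms *)
Section BinaryForms.
Variable K : fieldType.
Local Notation S := {mpoly K[2]}.
Local Notation x := (x_ K).
Local Notation q := (q_ K).

Definition pt (c d : K) : 'I_2 -> K := fun i => if i == ord0 then c else d.

Lemma pt_x c d : x.@[pt c d] = c.
Proof. by rewrite mevalXU. Qed.

Lemma pt_q c d : q.@[pt c d] = d.
Proof. by rewrite mevalXU. Qed.

Lemma x_homog : homogz 1 x.
Proof. by rewrite /= dhomogX; apply/eqP; exact: mdeg1. Qed.

Lemma q_homog : homogz 1 q.
Proof. by rewrite /= dhomogX; apply/eqP; exact: mdeg1. Qed.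

Lemma homogzZ d (c : K) (p : S) : homogz d p -> homogz d (c *: p).
Proof.
by case: d => n /=; [exact: rpredZ | move/eqP->; rewrite scaler0].
Qed.

Lemma homogzB d (p r : S) : homogz d p -> homogz d r -> homogz d (p - r).
Proof. by move=> hp hr; apply: homogzD => //; apply: homogzN. Qed.

Lemma homogzX d (p : S) n : homogz d p -> homogz (d * n%:Z) (p ^+ n).
Proof.
move=> hp; elim: n => [|n IH]; first by rewrite mulr0 expr0 /= dhomog1.
rewrite exprS; have -> : d * n.+1%:Z = d + d * n%:Z by lia.
exact: homogzM.
Qed.

Lemma monomialE (m : 'X_{1..2}) :
  'X_[m] = x ^+ (m ord0) * q ^+ (m ord_max) :> S.
Proof.
rewrite /x_ /q_ !mpolyXn -mpolyXD; congr mpolyX; apply/mnmP => i.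
rewrite mnmDE !mulmnE !mnm1E; case: i => -[|[|//]] hi /=.
  rewrite (_ : Ordinal hi = ord0); last exact: val_inj.
  by rewrite mul1n addn0.
rewrite (_ : Ordinal hi = ord_max); last exact: val_inj.
by rewrite mul1n.
Qed.

(** Modulo [x + c q] every form of degree [d] is a multiple of [q ^+ d], and
    the multiple is its value at [(-c, 1)]: this holds for monomials, by
    replacing the factors [x] by [- c q] one at a time. *)
Lemma factor_homog (c : K) d (p : S) : homogz d p -> p.@[pt (- c) 1] = 0 ->
  exists2 w, homogz (d - 1) w & p = (x + c *: q) * w.
Proof.
case: d => n; last first.
  by move=> /= /eqP-> _; exists 0; rewrite ?mulr0 // homogz0.
move=> hp.
(* The value at [(-c, 1)] then forces the coefficient [e] to be zero. *)
suff [e [w [hw ->]]] : exists e w, homogz (n%:Z - 1) w /\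
    p = (x + c *: q) * w + e *: q ^+ n.
  rewrite mevalD mevalM mevalD !mevalZ rmorphXn /= !pt_x pt_q expr1n !mulr1.
  rewrite addNr mul0r add0r => ->; exists w => //.
  by rewrite scale0r addr0.
rewrite (mpolyE p) big_seq; elim/big_ind: _ => [|u v|m hm].
- exists 0, 0; rewrite mulr0 scale0r addr0; split=> //; exact: homogz0.
- move=> [e [w [hw ->]]] [e' [w' [hw' ->]]].
  exists (e + e'), (w + w'); split; first exact: homogzD.
  by rewrite mulrDr scalerDl addrACA.
have mdE : (m ord0 + m ord_max)%N = n.
  move/dhomogP: hp => /(_ _ hm) <-.
  rewrite /= mdegE !big_ord_recl big_ord0 addn0.
  by congr (_ + m _)%N; exact: val_inj.
suff [e [w [hw E]]] : exists e w, homogz (n%:Z - 1) w /\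
    x ^+ m ord0 * q ^+ m ord_max = (x + c *: q) * w + e *: q ^+ n.
  exists (p@_m * e), (p@_m *: w); split; first exact: homogzZ.
  by rewrite monomialE E scalerDr scalerAr scalerA.
rewrite -mdE; move: (m ord0) (m ord_max) => a b.
elim: a => [|a [e [w [hw E]]]].
  by exists 1, 0; rewrite homogz0 mulr0 add0r scale1r mul1r.
exists (- c * e), (x * w + e *: q ^+ (a + b)); split.
  apply: homogzD; last first.
    by apply: homogzZ; have := homogzX (a + b) q_homog; congr homogz; lia.
  by have := homogzM x_homog hw; congr homogz; lia.
rewrite exprS -mulrA E addSn exprS -!mul_mpolyC mpolyCM mpolyCN; ring.
Qed.

End BinaryForms.

Lemma set_ind (T : finType) (P : {set T} -> Prop) :
  P set0 -> (forall i (A : {set T}), i \notin A -> P A -> P (i |: A)) ->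
  forall A, P A.
Proof.
move=> P0 P1 A; elim: {A}#|A| {-2}A (erefl #|A|) => [|n IH] A.
  by move/eqP; rewrite cards_eq0 => /eqP->.
move=> cA; have [A0|[i iA]] := set_0Vmem A; first by rewrite A0 cards0 in cA.
rewrite -(setD1K iA); apply: P1; first by rewrite !inE eqxx.
by apply: IH; move: cA; rewrite (cardsD1 i) iA => -[].
Qed.

Lemma disjoint_setU1 (T : finType) i (A B : {set T}) :
  [disjoint i |: A & B] = (i \notin B) && [disjoint A & B].
Proof. by rewrite -disjointU1; apply: eq_disjoint => j; rewrite !inE. Qed.

Section LinearProducts.
Variables (K : fieldType) (mu : nat) (s : 'I_mu.+1 -> K).
Local Notation S := {mpoly K[2]}.
Local Notation x := (x_ K).
Local Notation q := (q_ K).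
Local Notation lin i := (x + s i *: q).
Implicit Types A B : {set 'I_mu.+1}.

Lemma linprod0 : linprod s set0 = 1.
Proof. by rewrite /linprod big_set0. Qed.

Lemma linprod1 i : linprod s [set i] = lin i.
Proof. by rewrite /linprod big_set1. Qed.

Lemma linprodU A B : [disjoint A & B] ->
  linprod s (A :|: B) = linprod s A * linprod s B.
Proof.
move=> AB; rewrite /linprod -bigU //.
by apply: eq_bigl => i; rewrite !inE.
Qed.

Lemma linprodU1 i A : i \notin A -> linprod s (i |: A) = lin i * linprod s A.
Proof. by move=> iA; rewrite /linprod big_setU1. Qed.

Lemma linprodD A B : A \subset B ->
  linprod s B = linprod s A * linprod s (B :\: A).
Proof.
move=> AB; rewrite -linprodU; last first.
  by rewrite disjoints_subset setCD subsetUr.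
by rewrite -{1}(setID B A) (setIidPr AB).
Qed.

Lemma linprod_homogz A : homogz #|A| (linprod s A).
Proof. exact: linprod_homog. Qed.

Lemma linprod_eval A c d :
  (linprod s A).@[pt c d] = \prod_(i in A) (c + s i * d).
Proof.
rewrite /linprod rmorph_prod; apply: eq_bigr => i _.
by rewrite /= mevalD mevalZ pt_x pt_q.
Qed.

Lemma linprod_eval_inf A : (linprod s A).@[pt 1 0] = 1.
Proof.
by rewrite linprod_eval big1 // => i _; rewrite mulr0 addr0.
Qed.

Lemma linprod_neq0 A : linprod s A != 0.
Proof.
apply/eqP => /(congr1 (meval (pt 1 0))) /eqP.
by rewrite linprod_eval_inf meval0 oner_eq0.
Qed.

Hypothesis s_inj : injective s.

Lemma linprod_eval_root A i :
  ((linprod s A).@[pt (- s i) 1] == 0) = (i \in A).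
Proof.
rewrite linprod_eval; apply/idP/idP => [/prodf_eq0 [j jA]|iA].
  by rewrite mulr1 addrC subr_eq0 => /eqP /s_inj <-.
by apply/prodf_eq0; exists i => //; rewrite mulr1 addNr.
Qed.

(** The linear forms in [A] do not vanish at the roots of those in [B], so they
    can be taken out of [u] one after the other. *)
Lemma linprod_coprime A B d (u v : S) : [disjoint A & B] -> homogz d u ->
  u * linprod s B = linprod s A * v ->
  exists2 w, homogz (d - #|A|%:Z) w & u = linprod s A * w.
Proof.
elim/set_ind: A d u v => [|i A iA IH] d u v.
  by move=> _ hu _; exists u; rewrite ?linprod0 ?mul1r // cards0 subr0.
rewrite disjoint_setU1 => /andP[iB AB] hu.
rewrite linprodU1 // => E.
have [|w hw uE] := factor_homog (c := s i) hu.
  have /(congr1 (meval (pt (- s i) 1))) := E.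
  rewrite !mevalM mevalD mevalZ pt_x pt_q mulr1 addNr !mul0r => /eqP.
  by rewrite mulf_eq0 linprod_eval_root (negbTE iB) orbF => /eqP.
have [|w' hw' wE] := IH (d - 1) w v AB hw.
  have lin0 : lin i != 0 by rewrite -linprod1 linprod_neq0.
  by apply: (mulfI lin0); rewrite mulrA -uE E !mulrA.
exists w'; last by rewrite uE wE mulrA.
by move: hw'; rewrite cardsU1 iA; congr homogz; lia.
Qed.

(** [S / (f_A, f_B)] is a graded complete intersection, whose last nonzero
    degree is [|A| + |B| - 2].  In the induction on [A], the coefficient of
    [f_A] still has degree at least [|B|]; a multiple of [q ^+ e * f_B] makes it
    vanish at the next root. *)
Lemma linprod_nullstellensatz A B (d : int) (u : S) : [disjoint A & B] ->
  (#|A|%:Z + #|B|%:Z - 1 <= d) -> homogz d u ->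
  exists g k, [/\ homogz (d - #|A|%:Z) g, homogz (d - #|B|%:Z) k &
    u = linprod s A * g + linprod s B * k].
Proof.
elim/set_ind: A => [|i A iA IH].
  move=> _ _ hu; exists u, 0; rewrite linprod0 mul1r mulr0 addr0 cards0 subr0.
  by rewrite homogz0.
rewrite disjoint_setU1 cardsU1 iA => /andP[iB AB] hd hu.
have [||g [k [hg hk uE]]] := IH AB; [lia | by [] |].
have Bi : (linprod s B).@[pt (- s i) 1] != 0 by rewrite linprod_eval_root.
have [e he] : exists e : nat, d - #|A|%:Z = #|B|%:Z + e%:Z.
  by exists (absz (d - #|A|%:Z - #|B|%:Z)%R); lia.
pose c := g.@[pt (- s i) 1] / (linprod s B).@[pt (- s i) 1].
have hq : homogz e (c *: q ^+ e).
  by apply: homogzZ; have := homogzX e (q_homog K); rewrite mul1r.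
have hcq : homogz (d - #|A|%:Z) (linprod s B * (c *: q ^+ e)).
  by rewrite he; apply: homogzM => //; apply: linprod_homogz.
have [|w hw gE] := factor_homog (c := s i) (homogzB hg hcq).
  rewrite mevalB mevalM mevalZ rmorphXn /= pt_q expr1n mulr1.
  by rewrite mulrC divfK // subrr.
exists w, (linprod s A * (c *: q ^+ e) + k); split.
- by move: hw; congr homogz; lia.
- apply: homogzD => //; have := homogzM (linprod_homogz A) hq.
  by congr homogz; lia.
have -> : u = linprod s A * (g - linprod s B * (c *: q ^+ e))
   + linprod s B * (linprod s A * (c *: q ^+ e) + k) by rewrite uE; ring.
by rewrite gE linprodU1 //; ring.
Qed.

End LinearProducts.

(** * Translation and shift *)
Section Translation.
Variables (K : fieldType) (h : nat) (f : {mpoly K[2]}).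
Local Notation S := {mpoly K[2]}.
Local Notation mf := (mf h f).
Implicit Types X Y : mf.

Lemma MF_congr n0 n1 (a0 b0 : 'rV[int]_n0) (a1 b1 : 'rV[int]_n1)
    (A A' : 'M[S]_(n1, n0)) (B B' : 'M[S]_(n0, n1)) p1 p2 p3 p4 q1 q2 q3 q4 :
  a0 = b0 -> a1 = b1 -> A = A' -> B = B' ->
  @MF K h f (GFree a0) (GFree a1) A B p1 p2 p3 p4
  = @MF K h f (GFree b0) (GFree b1) A' B' q1 q2 q3 q4.
Proof.
move=> ea eb eA eB; subst b0 b1 A' B'.
by congr MF; exact: Prop_irrelevance.
Qed.

Lemma mf_tauD m n X : mf_tau m (mf_tau n X) = mf_tau (n + m) X.
Proof.
case: X => -[n0 a0] [n1 a1] A B p1 p2 p3 p4; apply: MF_congr => //;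
by apply/rowP => i; rewrite !mxE addrA.
Qed.

Lemma mf_tau0 X : mf_tau 0 X = X.
Proof.
case: X => -[n0 a0] [n1 a1] A B p1 p2 p3 p4; apply: MF_congr => //;
by apply/rowP => i; rewrite !mxE addr0.
Qed.

Lemma mf_T_tau n X : mf_T (mf_tau n X) = mf_tau n (mf_T X).
Proof.
case: X => -[n0 a0] [n1 a1] A B p1 p2 p3 p4; apply: MF_congr => //;
by apply/rowP => i; rewrite !mxE addrAC.
Qed.

Lemma mf_TT X : mf_T (mf_T X) = mf_tau h X.
Proof.
case: X => -[n0 a0] [n1 a1] A B p1 p2 p3 p4; apply: MF_congr => //;
by rewrite opprK.
Qed.

Lemma mf_TiE X : mf_Ti X = mf_tau (- h%:Z) (mf_T X).
Proof.
case: X => -[n0 a0] [n1 a1] A B p1 p2 p3 p4; apply: MF_congr => //.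
by apply/rowP => i; rewrite !mxE addrK.
Qed.

(** Since [T^2 = tau^h], a power of [T] is a shift, up to one factor [T]. *)
Lemma tpowE (p : int) X : exists k : int,
  p = k *+ 2 /\ @tpow K (HMF h f) p X = mf_tau (h%:Z * k) X \/
  p = k *+ 2 + 1 /\ @tpow K (HMF h f) p X = mf_tau (h%:Z * k) (mf_T X).
Proof.
case: p => n /=.
  elim: n => [|n [k IH]].
    by exists 0; left; rewrite mulr0 mf_tau0.
  rewrite iterS; case: IH => -[nE ->].
    by exists k; right; rewrite /= mf_T_tau; split=> //; lia.
  exists (k + 1); left; rewrite /= mf_T_tau mf_TT mf_tauD.
  by split; [lia | congr mf_tau; ring].
have step (k p : int) Y :
    p = k *+ 2 /\ Y = mf_tau (h%:Z * k) X \/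
    p = k *+ 2 + 1 /\ Y = mf_tau (h%:Z * k) (mf_T X) ->
  exists k : int,
    p - 1 = k *+ 2 /\ mf_Ti Y = mf_tau (h%:Z * k) X \/
    p - 1 = k *+ 2 + 1 /\ mf_Ti Y = mf_tau (h%:Z * k) (mf_T X).
  rewrite mf_TiE => -[] [-> ->].
    exists (k - 1); right; rewrite mf_T_tau mf_tauD.
    by split; [lia | congr mf_tau; ring].
  exists k; left; rewrite mf_T_tau mf_TT !mf_tauD.
  by split; [lia | congr mf_tau; ring].
elim: n => [|n [k IH]] /=.
  by apply: (step 0 0); left; rewrite mulr0 mf_tau0.
rewrite (_ : Negz n.+1 = Negz n - 1); last by lia.
exact: step IH.
Qed.

End Translation.

(** * Isomorphisms and zero objects up to homotopy *)
Section Morphisms.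
Variables (K : fieldType) (h : nat) (f : {mpoly K[2]}).
Local Notation S := {mpoly K[2]}.
Local Notation mf := (mf h f).
Implicit Types X Y : mf.

Lemma hclass0P X Y (a : mfmor X Y) : hclass a = 0 <-> null_axiom a.
Proof.
have -> : (0 : hmf_hom X Y) = hclass 0 by rewrite /hclass raddf0.
by rewrite hclassP subr0; split => /asboolP.
Qed.

Lemma hom_eq0 X Y :
  (forall a : mfmor X Y, null_axiom a) ->
  forall a : @Defs.hom K (hmf_cat h f) X Y, a = 0.
Proof. by move=> H a; have [a' ->] := hclassK a; apply/hclass0P. Qed.

(** A homotopy equivalence that is a retraction on the nose: one composite is
    the identity, so that a single homotopy [(h0, h1)] has to be given. *)
Lemma isomorphicI X Y (a : mfpair X Y) (b : mfpair Y X)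
    (h0 : 'M[S]_(rk (F1 Y), rk (F0 Y))) (h1 : 'M[S]_(rk (F0 Y), rk (F1 Y))) :
  mfmor_axiom a -> mfmor_axiom b ->
  b.1 *m a.1 = 1%:M -> b.2 *m a.2 = 1%:M ->
  @ghom K (F0 Y) (F1 Y) (- h%:Z) h0 -> @ghom K (F1 Y) (F0 Y) 0 h1 ->
  a.1 *m b.1 - 1%:M = h1 *m f0 Y + f1 Y *m h0 ->
  a.2 *m b.2 - 1%:M = f0 Y *m h1 + h0 *m f1 Y ->
  @isomorphic K (hmf_cat h f) X Y.
Proof.
move=> aP bP ba1 ba2 h0P h1P ab1 ab2.
exists (hclass (mkmor aP)), (hclass (mkmor bP)); split; rewrite /= hclass_comp.
  by congr hclass; apply: val_inj; rewrite /= ba1 ba2.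
by apply/hclassP/asboolP; exists h0, h1; split.
Qed.

Lemma idm_is_iso (C : lincat K) (X : C) : is_iso (idm X).
Proof. by exists (idm X); rewrite cmp1. Qed.

Lemma isomorphic_sym (C : lincat K) (X Y : C) :
  isomorphic X Y -> isomorphic Y X.
Proof. by move=> [a [b [ba ab]]]; exists b, a. Qed.

Lemma isomorphic_strict X Y (a : mfpair X Y) (b : mfpair Y X) :
  mfmor_axiom a -> mfmor_axiom b ->
  b.1 *m a.1 = 1%:M -> b.2 *m a.2 = 1%:M ->
  a.1 *m b.1 = 1%:M -> a.2 *m b.2 = 1%:M ->
  @isomorphic K (hmf_cat h f) X Y.
Proof.
move=> aP bP ba1 ba2 ab1 ab2.
apply: (isomorphicI (h0 := 0) (h1 := 0) aP bP) => //;
  rewrite ?ab1 ?ab2 ?subrr ?mul0mx ?mulmx0 ?addr0 //; exact: ghom0.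
Qed.

Lemma zero_contractible X h0 h1 :
  @ghom K (F0 X) (F1 X) (- h%:Z) h0 -> @ghom K (F1 X) (F0 X) 0 h1 ->
  1%:M = h1 *m f0 X + f1 X *m h0 ->
  1%:M = f0 X *m h1 + h0 *m f1 X ->
  @idm K (hmf_cat h f) X = 0.
Proof. by move=> h0P h1P e0 e1; apply/hclass0P; exists h0, h1. Qed.

End Morphisms.

(** * Morphisms between rank one objects *)
Section RankOneMorphisms.
Variables (K : fieldType) (h : nat) (f : {mpoly K[2]}).
Local Notation S := {mpoly K[2]}.
Variables (a0 a1 b0 b1 : 'rV[int]_1) (A A' B B' : 'M[S]_1).
Variables (p1 : @ghom K (GFree a0) (GFree a1) 0 A)
  (p2 : @ghom K (GFree a1) (GFree a0) h A')
  (p3 : A' *m A = f%:M) (p4 : A *m A' = f%:M).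
Variables (q1 : @ghom K (GFree b0) (GFree b1) 0 B)
  (q2 : @ghom K (GFree b1) (GFree b0) h B')
  (q3 : B' *m B = f%:M) (q4 : B *m B' = f%:M).
Local Notation X := (MF p1 p2 p3 p4).
Local Notation Y := (MF q1 q2 q3 q4).

Lemma mx11E (R : pzRingType) (M N : 'M[R]_1) : M 0 0 = N 0 0 -> M = N.
Proof. by move=> E; apply/matrixP => i j; rewrite !ord1. Qed.

Lemma mulmx11 (R : pzRingType) (M N : 'M[R]_1) : (M *m N) 0 0 = M 0 0 * N 0 0.
Proof. by rewrite mxE big_ord1. Qed.

Lemma rank1_mfmor (phi : mfmor X Y) (u := (mfval phi).1 0 0)
    (v := (mfval phi).2 0 0) :
  [/\ homogz (b0 0 0 - a0 0 0) u, homogz (b1 0 0 - a1 0 0) v,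
      v * A 0 0 = B 0 0 * u & u * A' 0 0 = B' 0 0 * v].
Proof.
have [/ghomP h0 /ghomP h1 e0 e1] := mfmorP phi; split.
- by have := h0 0 0; rewrite add0r.
- by have := h1 0 0; rewrite add0r.
- by have := congr1 (fun M : 'M_1 => M 0 0) e0; rewrite !mulmx11.
- by have := congr1 (fun M : 'M_1 => M 0 0) e1; rewrite !mulmx11.
Qed.

Lemma rank1_nullP (phi : mfmor X Y) (u := (mfval phi).1 0 0)
    (v := (mfval phi).2 0 0) :
  null_axiom phi <-> exists g0 g1,
    [/\ homogz (b1 0 0 - a0 0 0 - h%:Z) g0, homogz (b0 0 0 - a1 0 0) g1,
        u = g1 * A 0 0 + B' 0 0 * g0 & v = B 0 0 * g1 + g0 * A' 0 0].
Proof.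
split.
  move=> [h0 [h1 [/ghomP h0P /ghomP h1P e0 e1]]].
  exists (h0 0 0), (h1 0 0); split.
  - by have := h0P 0 0; congr homogz; rewrite /=; ring.
  - by have := h1P 0 0; congr homogz; rewrite /=; ring.
  - by rewrite /u e0 mxE !mulmx11.
  - by rewrite /v e1 mxE !mulmx11.
move=> [g0 [g1 [h0P h1P e0 e1]]]; exists (const_mx g0), (const_mx g1); split.
- apply/ghomP => i j; rewrite !ord1 mxE; move: h0P; congr homogz.
  by rewrite /=; ring.
- apply/ghomP => i j; rewrite !ord1 mxE; move: h1P; congr homogz.
  by rewrite /=; ring.
- by apply: mx11E; rewrite mxE !mulmx11 !mxE.
- by apply: mx11E; rewrite mxE !mulmx11 !mxE.
Qed.

End RankOneMorphisms.

Section RankOneHoms.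
Variables (K : fieldType) (mu : nat) (t : 'I_mu -> K) (s : 'I_mu.+1 -> K).
Variables (ts : is_param t s) (s_inj : injective s).
Local Notation S := {mpoly K[2]}.
Local Notation h := mu.+1.
Local Notation F n I := (mf_tau n (rank_one ts I)).
Implicit Types (I J : {set 'I_mu.+1}) (m n : int).

Lemma subset_cardC I J : I \subset J -> exists d : nat,
  [/\ #|J| = (#|I| + d)%N, (#|I| + d + #|~: J| = h)%N &
      #|~: I| = (#|~: J| + d)%N].
Proof.
move=> IJ; exists #|J :\: I|; rewrite cardsD (setIidPr IJ).
have := subset_leq_card IJ; have := cardsC I; have := cardsC J.
by rewrite card_ord; split; lia.
Qed.

Lemma linprod_setCD I J : I \subset J ->
  linprod s (~: I) = linprod s (J :\: I) * linprod s (~: J).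
Proof.
move=> IJ; rewrite [RHS]mulrC -setCS in IJ *.
rewrite (linprodD s IJ); congr (_ * linprod s _).
by apply/setP => i; rewrite !inE negbK andbC.
Qed.

Lemma homogz_lt0 (d : int) (p : S) : d < 0 -> homogz d p -> p = 0.
Proof. by case: d => // n _ /= /eqP. Qed.

(** The degrees allowed here are those where [S / (f_I, f_J)] is zero. *)
Lemma form_in_ideal (I J : {set 'I_mu.+1}) (d : int) (u : S) :
  [disjoint I & J] -> d < 0 \/ #|I|%:Z + #|J|%:Z - 1 <= d -> homogz d u ->
  exists g k, [/\ homogz (d - #|I|%:Z) g, homogz (d - #|J|%:Z) k &
    u = linprod s I * g + linprod s J * k].
Proof.
move=> IJ [d0 /(homogz_lt0 d0) ->|]; last exact: linprod_nullstellensatz.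
by exists 0, 0; rewrite !mulr0 addr0; split => //; exact: homogz0.
Qed.

(** The pair [(u, v)] stands for a morphism and the pair [(g0, g1)] for a
    homotopy from it to zero. *)
Lemma even_hom_eq0 I J m n :
  (forall u v : S, homogz (n - m) u ->
     homogz (n + #|J|%:Z - (m + #|I|%:Z)) v ->
     v * linprod s I = linprod s J * u ->
     u * linprod s (~: I) = linprod s (~: J) * v ->
     exists g0 g1, [/\ homogz (n + #|J|%:Z - m - h%:Z) g0,
       homogz (n - (m + #|I|%:Z)) g1,
       u = g1 * linprod s I + linprod s (~: J) * g0 &
       v = linprod s J * g1 + g0 * linprod s (~: I)]) ->
  forall a : @Defs.hom K (hmf_cat h (ftilde t)) (F m I) (F n J), a = 0.
Proof.
move=> H; apply: hom_eq0 => phi; apply/rank1_nullP.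
have [] := rank1_mfmor phi.
move: ((mfval phi).1 0 0) ((mfval phi).2 0 0) => u v {phi}.
rewrite !mxE /= !mulr1n => hu hv e0 e1.
have [|| // | //|g0 [g1 [h0 h1 uE vE]]] := H u v.
- by move: hu; congr homogz; ring.
- by move: hv; congr homogz; ring.
exists g0, g1; split=> //.
- by move: h0; congr homogz; ring.
- by move: h1; congr homogz; ring.
Qed.

Lemma odd_hom_eq0 I J m n :
  (forall u v : S, homogz (n + #|J|%:Z - m) u ->
     homogz (n + h%:Z - (m + #|I|%:Z)) v ->
     v * linprod s I = - linprod s (~: J) * u ->
     u * linprod s (~: I) = - linprod s J * v ->
     exists g0 g1, [/\ homogz (n - m) g0,
       homogz (n + #|J|%:Z - (m + #|I|%:Z)) g1,
       u = g1 * linprod s I + - linprod s J * g0 &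
       v = - linprod s (~: J) * g1 + g0 * linprod s (~: I)]) ->
  forall a : @Defs.hom K (hmf_cat h (ftilde t)) (F m I)
    (mf_tau n (mf_T (rank_one ts J))), a = 0.
Proof.
move=> H; apply: hom_eq0 => phi; apply/rank1_nullP.
have [] := rank1_mfmor phi.
move: ((mfval phi).1 0 0) ((mfval phi).2 0 0) => u v {phi}.
rewrite !mxE /= !mulr1n => hu hv e0 e1.
have [|| // | //|g0 [g1 [h0 h1 uE vE]]] := H u v.
- by move: hu; congr homogz; ring.
- by move: hv; congr homogz; ring.
exists g0, g1; split=> //.
- by move: h0; congr homogz; ring.
- by move: h1; congr homogz; ring.
Qed.

(** If [I] is contained in [J], then [v = f_(J - I) u], and [(u, v)] is
    null-homotopic when [u] lies in the ideal generated by [f_I] and the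
    complement of [f_J]. *)
Lemma hom_even_sub I J m n : I \subset J ->
  n - m < 0 \/ #|I|%:Z + #|~: J|%:Z - 1 <= n - m ->
  forall a : @Defs.hom K (hmf_cat h (ftilde t)) (F m I) (F n J), a = 0.
Proof.
move=> IJ hd; apply: even_hom_eq0 => u v hu hv e0 e1.
have [|g1 [g0 [hg1 hg0 uE]]] := form_in_ideal (I := I) (J := ~: J) _ hd hu.
  by rewrite disjoints_subset setCK.
have [d [dJ dh dI]] := subset_cardC IJ.
exists g0, g1; split.
- by move: hg0; congr homogz; lia.
- by move: hg1; congr homogz; lia.
- by rewrite uE [X in X + _]mulrC.
apply: (mulfI (linprod_neq0 s I)); rewrite mulrC e0 uE.
rewrite (linprod_setCD IJ) (linprodD s IJ); ring.
Qed.

(** Here [u = f_(I - J) v], so that [v] is the form to be put in the ideal. *)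
Lemma hom_even_sup I J m n : J \subset I ->
  n + #|J|%:Z - (m + #|I|%:Z) < 0 \/ h%:Z - 1 <= n - m ->
  forall a : @Defs.hom K (hmf_cat h (ftilde t)) (F m I) (F n J), a = 0.
Proof.
move=> JI hd; apply: even_hom_eq0 => u v hu hv e0 e1.
have [d [dI dh dJ]] := subset_cardC JI.
have [||g1 [g0 [hg1 hg0 vE]]] := form_in_ideal (I := J) (J := ~: I) _ _ hv.
- by rewrite disjoints_subset setCK.
- by case: hd; lia.
exists g0, g1; split.
- by move: hg0; congr homogz; lia.
- by move: hg1; congr homogz; lia.
- apply: (mulfI (linprod_neq0 s J)); rewrite -e0 vE.
  rewrite (linprod_setCD JI) (linprodD s JI); ring.
- by rewrite vE [X in _ + X]mulrC.
Qed.

(** The relations give [u * (f / f_J) = - f_I * v] with coprime [f_I] and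
    [f / f_J], so that [f_I] divides [u]. *)
Lemma hom_odd_sub I J m n : I \subset J ->
  forall a : @Defs.hom K (hmf_cat h (ftilde t)) (F m I)
    (mf_tau n (mf_T (rank_one ts J))), a = 0.
Proof.
move=> IJ; apply: odd_hom_eq0 => u v hu hv e0 e1.
have [|//|w hw uE] :=
  linprod_coprime (A := I) (B := ~: J) (v := - v) s_inj _ hu.
- by rewrite disjoints_subset setCK.
- by rewrite mulrN (mulrC _ v) e0; ring.
exists 0, w; split; first exact: homogz0.
- by move: hw; congr homogz; lia.
- by rewrite uE mulr0 addr0 mulrC.
apply: (mulfI (linprod_neq0 s I)); rewrite mulrC e0 uE; ring.
Qed.

Lemma hom_odd_sup I J m n : J \subset I ->
  forall a : @Defs.hom K (hmf_cat h (ftilde t)) (F m I)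
    (mf_tau n (mf_T (rank_one ts J))), a = 0.
Proof.
move=> JI; apply: odd_hom_eq0 => u v hu hv e0 e1.
have [|//|w hw uE] :=
  linprod_coprime (A := J) (B := ~: I) (v := - v) s_inj _ hu.
- by rewrite disjoints_subset setCK.
- by rewrite e1; ring.
have [d [dI dh dJ]] := subset_cardC JI.
exists (- w), 0; split.
- by apply: homogzN; move: hw; congr homogz; lia.
- exact: homogz0.
- by rewrite uE mul0r add0r; ring.
apply: (mulfI (linprod_neq0 s J)).
have -> : linprod s J * v = - (u * linprod s (~: I)) by rewrite e1; ring.
rewrite uE; ring.
Qed.

End RankOneHoms.

(** * Strong exceptionality *)
Section Exceptional.
Variables (K : fieldType) (mu : nat) (t : 'I_mu -> K) (s : 'I_mu.+1 -> K).
Variables (ts : is_param t s) (s_inj : injective s).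
Local Notation S := {mpoly K[2]}.
Local Notation h := mu.+1.
Local Notation F n I := (mf_tau n (rank_one ts I)).
Local Notation T := (HMF h (ftilde t)).
Implicit Types (I J : {set 'I_mu.+1}) (m n : int).

(** For [p = 2 k] the relevant form has degree [h k + e' - e], up to the
    difference of the cardinalities.  When [k] is not zero this leaves the
    range [0, ..., |A| + |B| - 2], because [e' - e] is at most 1 in absolute
    value and [|A| + |B|] is at most [h].  When [k = 0] the other two
    alternatives of the last hypothesis make the degree negative. *)
Lemma hom_tpow_eq0 (p : int) (e e' : bool) I J :
  (0 < #|I| <= mu)%N -> (0 < #|J| <= mu)%N -> I \subset J \/ J \subset I ->
  [\/ p != 0, e && ~~ e' | e = e' /\ J \proper I] ->
  forall a : @Defs.hom K T (F e%:Z I) (@tpow K T p (F e'%:Z J)), a = 0.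
Proof.
move=> /andP[I1 Imu] /andP[J1 Jmu] chain hp.
have [k [] [pE ->]] := tpowE p (F e'%:Z J); last first.
  rewrite mf_T_tau mf_tauD.
  by case: chain => IJ; [exact: hom_odd_sub | exact: hom_odd_sup].
rewrite mf_tauD.
(* The linear arithmetic below needs the product [h k] bounded away from 0. *)
have hk : [\/ h%:Z * k <= - h%:Z, h%:Z * k >= h%:Z | k = 0].
  have [k0|k0|->] := ltgtP k 0; last by apply: Or33.
    by apply: Or31; nia.
  by apply: Or32; nia.
have e1 : (e <= 1)%N by case: (e).
have e1' : (e' <= 1)%N by case: (e').
have : (I \subset J) || (J \proper I).
  by case: chain => [->//|JI]; rewrite properE JI orbN.
move=> /orP[IJ|JI].
- apply: hom_even_sub => //; have [d [dJ dh dI]] := subset_cardC IJ.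
  case: hk => hk; [by left; lia|by right; lia|].
  left; rewrite hk mulr0 addr0; case: hp; first by rewrite pE hk.
    by case: (e) (e') => -[].
  by move=> [_ /properP [JI [i iI]]]; rewrite (subsetP IJ).
- have := proper_card JI; move: JI => /proper_sub JI lt.
  apply: hom_even_sup => //; have [d [dJ dh dI]] := subset_cardC JI.
  case: hk => hk; [by left; lia|by right; lia|].
  left; rewrite hk mulr0 addr0; case: hp; first by rewrite pE hk.
    case: (e) (e') => -[] // _; lia.
  by move=> [-> _]; lia.
Qed.

Lemma homogz0_const (u : S) : homogz 0 u -> u = (u.@[pt 0 1])%:MP.
Proof.
move=> hu; have hc : homogz 0 (u - (u.@[pt 0 1])%:MP).
  apply: homogzB => //.
  by rewrite -alg_mpolyC; apply: homogzZ; rewrite /= dhomog1.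
have [|w hw E] := factor_homog (c := 0) hc.
  by rewrite oppr0 mevalB mevalC subrr.
by apply/eqP; rewrite -subr_eq0 E (homogz_lt0 _ hw) // mulr0.
Qed.

Lemma hclassZ h' f (X Y : mf h' f) (c : K) (a : mfmor X Y) :
  c *: hclass a = hclass (c *: a).
Proof. by rewrite /hclass linearZ. Qed.

(** The endomorphisms are the degree 0 part of [S / (f_I, f / f_I)]; both
    generators have positive degree, so nothing is divided out. *)
Lemma rank_one_endo n I : (0 < #|I| <= mu)%N ->
  bijective (fun c : K => c *: idm (F n I : T)).
Proof.
move=> /andP[I1 Imu].
have inj (c : K) : c *: idm (F n I : T) = 0 -> c = 0.
  rewrite [LHS]hclassZ => /hclass0P/rank1_nullP[g0 [g1 []]].
  rewrite !mxE /= !mulr1n mulr1 => hg0 hg1.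
  have {}hg0 : homogz (#|I|%:Z - h%:Z) g0 by move: hg0; congr homogz; ring.
  have {}hg1 : homogz (- #|I|%:Z) g1 by move: hg1; congr homogz; ring.
  rewrite (homogz_lt0 _ hg0); last by lia.
  rewrite (homogz_lt0 _ hg1); last by lia.
  by rewrite mul0r mulr0 addr0 => /eqP; rewrite mpolyC_eq0 => /eqP.
have surj (a : Defs.hom (F n I : T) (F n I)) :
    exists c, c *: idm (F n I : T) = a.
  have [phi ->] := hclassK a.
  have [] := rank1_mfmor phi; set u := (mfval phi).1 0 0 => hu _ e0 _.
  have {}hu : homogz 0 u by move: hu; congr homogz; ring.
  exists u.@[pt 0 1]; rewrite [LHS]hclassZ; congr hclass; apply: val_inj.
  rewrite /= -(homogz0_const hu) {hu}/u in e0 *.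
  move: e0; case: (mfval phi) => phi0 phi1 /=; rewrite !mxE /= mulr1n mulrC.
  move=> /(mulfI (linprod_neq0 s I)) e0.
  by congr pair; apply: mx11E; rewrite !mxE ?e0 mulr1.
pose g a := sval (cid (surj a)).
exists g => [c|a]; last by rewrite /g; case: cid.
apply/eqP; rewrite -subr_eq0; apply/eqP/inj.
by rewrite scalerBl /g; case: cid => c' /= ->; rewrite subrr.
Qed.

End Exceptional.

Section StronglyExceptional.
Variables (K : fieldType) (mu : nat) (t : 'I_mu -> K) (s : 'I_mu.+1 -> K).
Variables (ts : is_param t s) (s_inj : injective s).
Variables (a : 'I_mu -> 'I_mu.+1) (a_inj : injective a).
Local Notation h := mu.+1.
Local Notation F n I := (mf_tau n (rank_one ts I)).
Local Notation T := (HMF h (ftilde t)).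

Lemma index_set_sub (i j : 'I_mu) : (i <= j)%N ->
  index_set a i \subset index_set a j.
Proof.
move=> ij; apply/imsetS/subsetP => k; rewrite !inE => ki.
exact: leq_trans ki ij.
Qed.

Lemma card_ord_le n (i : 'I_n) : #|[pred j : 'I_n | (j <= i)%N]| = i.+1.
Proof.
have hi : (i.+1 <= n)%N by [].
have inj : injective (widen_ord hi).
  by move=> j k /(congr1 val) /= /val_inj.
rewrite -[RHS]card_ord -(card_imset _ inj).
apply: eq_card => j; rewrite inE; apply/idP/imsetP => [ji|[k _ ->]]; last first.
  by rewrite /= -ltnS.
by exists (Ordinal (n := i.+1) (m := j) ji) => //; apply: val_inj.
Qed.

Lemma card_index_set (i : 'I_mu) : #|index_set a i| = i.+1.
Proof.
by rewrite card_imset // -[RHS]card_ord_le; apply: eq_card => j; rewrite !inE.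
Qed.

Lemma collectionE (k : 'I_(mu + mu)) : exists (e : bool) (i : 'I_mu),
  collection ts a k = F e%:Z (index_set a i) /\ k = (e * mu + i)%N :> nat.
Proof.
rewrite /collection; case: splitP => i ki.
  by exists false, i; rewrite mf_tau0.
by exists true, i; rewrite mul1n.
Qed.

Lemma collection_strongly_exceptional : strongly_exceptional (collection ts a).
Proof.
have card_ok (i : 'I_mu) : (0 < #|index_set a i| <= mu)%N.
  by rewrite card_index_set /=.
have chain (i j : 'I_mu) :
    index_set a i \subset index_set a j \/ index_set a j \subset index_set a i.
  by case/orP: (leq_total i j) => ij; [left|right]; apply: index_set_sub.
split; [split|].
- move=> k; have [e [i [-> _]]] := collectionE k; split.
    exact: rank_one_endo.
  by move=> p p0; apply: hom_tpow_eq0 => //; apply: Or31.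
- move=> p m n; have [e [i [-> ->]]] := collectionE m.
  have [e' [j [-> ->]]] := collectionE n => nm.
  apply: hom_tpow_eq0 => //.
  have [hi hj] := (ltn_ord i, ltn_ord j).
  case: e e' nm => -[] /=; rewrite ?mul1n ?mul0n ?add0n => nm.
  + apply: Or33; split=> //.
    by rewrite properEcard index_set_sub ?card_index_set; lia.
  + exact: Or32.
  + lia.
  + apply: Or33; split=> //.
    by rewrite properEcard index_set_sub ?card_index_set; lia.
- move=> p p0 m n; have [e [i [-> _]]] := collectionE m.
  have [e' [j [-> _]]] := collectionE n.
  by apply: hom_tpow_eq0 => //; apply: Or31.
Qed.

End StronglyExceptional.

(** * Cones and triangulated subcategories *)

(** The four identities behind the rotation of a triangle: the cone of
    [Y -> cone p] is [T X].  They are used twice, the second time with the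
    components of degrees 0 and 1 exchanged. *)
Section RotationBlocks.
Variables (R : comPzRingType) (m0 m1 n0 n1 : nat).
Variables (g1 : 'M[R]_(m0, m1)) (g0 : 'M[R]_(m1, m0)).
Variables (k0 : 'M[R]_(n1, n0)) (k1 : 'M[R]_(n0, n1)).
Variables (p0 : 'M[R]_(n0, m0)) (p1 : 'M[R]_(n1, m1)).

Lemma rot_in : p0 *m g1 = k1 *m p1 ->
  col_mx (- p0) (col_mx 1%:M (0 : 'M_(n1, m0))) *m (- g1) =
  block_mx (- k1) 0 (col_mx 0 1%:M) (block_mx (- g1) 0 p1 k0)
    *m col_mx (- p1) (col_mx 1%:M 0).
Proof.
move=> E; rewrite mul_col_mx mul_col_mx mul_block_col mul_block_col mul_col_mx.
rewrite !mul0mx !mul1mx !mulmx0 !mulmx1 !addr0 add_col_mx add0r addNr.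
by rewrite mulmxN mulNmx opprK mulmxN mulNmx opprK E.
Qed.

Lemma rot_out :
  row_mx 0 (row_mx 1%:M 0)
    *m block_mx (- k1) 0 (col_mx 0 1%:M) (block_mx (- g1) 0 p1 k0) =
  (- g1) *m row_mx (0 : 'M_(m1, n1)) (row_mx 1%:M (0 : 'M_(m1, n0))).
Proof.
rewrite mul_row_block mul_mx_row mul_mx_row mul_row_block mul_row_col.
by rewrite !mul0mx !mulmx0 !mul1mx !mulmx1 !addr0 add0r.
Qed.

Lemma rot_section : row_mx (0 : 'M_(m1, n1)) (row_mx 1%:M (0 : 'M_(m1, n0)))
  *m col_mx (- p1) (col_mx 1%:M 0) = 1%:M.
Proof. by rewrite !mul_row_col !mul0mx mul1mx addr0 add0r. Qed.

Lemma rot_homotopy :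
  col_mx (- p1) (col_mx 1%:M 0) *m row_mx 0 (row_mx 1%:M 0) - 1%:M =
  block_mx 0 (row_mx 0 (- 1%:M)) 0 0
    *m block_mx (- k1) 0 (col_mx 0 1%:M) (block_mx (- g1) 0 p1 k0)
  + block_mx (- k0) 0 (col_mx 0 1%:M) (block_mx (- g0) 0 p0 k1)
    *m block_mx 0 (row_mx 0 (- 1%:M)) 0 0.
Proof.
rewrite mulmx_block mulmx_block mul_col_row mul_row_block.
rewrite mul_row_col (mul_col_row 1%:M) (mul_col_row 0) !mul_mx_row.
rewrite !mul0mx !mulmx0 !mulNmx !mul1mx !mulmxN !mulmx1 !(addr0, add0r, oppr0).
rewrite scalar_mx_block scalar_mx_block.
rewrite opp_block_mx add_block_mx add_block_mx opp_block_mx add_block_mx.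
rewrite add_row_mx !(addr0, add0r, oppr0, subrr).
by [].
Qed.

End RotationBlocks.

Section Triangles.
Variables (K : fieldType) (h : nat) (f : {mpoly K[2]}).
Local Notation S := {mpoly K[2]}.
Local Notation mf := (mf h f).
Local Notation T := (HMF h f).

Lemma cone_cone_in (X Y : mf) (p : mfmor X Y) :
  isomorphic (mf_T X : T) (cone (cone_in p)).
Proof.
have [p0P p1P p10 p01] := mfmorP p.
apply: (isomorphicI (X := mf_T X) (Y := cone (cone_in p))
  (a := (col_mx (- (mfval p).2) (col_mx 1%:M 0),
         col_mx (- (mfval p).1) (col_mx 1%:M 0)))
  (b := (row_mx 0 (row_mx 1%:M 0), row_mx 0 (row_mx 1%:M 0)))
  (h0 := block_mx 0 (row_mx 0 (- 1%:M)) 0 0)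
  (h1 := block_mx 0 (row_mx 0 (- 1%:M)) 0 0)).
- split; [| |by apply: rot_in|by apply: rot_in].
    apply: ghom_col; first exact: ghomN.
    by apply: ghom_col; [exact: ghom1 | exact: ghom0].
  apply: ghom_col; first by apply: ghomN; exact: ghom_tau.
  by apply: ghom_col; [exact: ghom1 | exact: ghom0].
- split.
  + apply: ghom_row; first exact: ghom0.
    by apply: ghom_row; [exact: ghom1 | exact: ghom0].
  + apply: ghom_row; first exact: ghom0.
    by apply: ghom_row; [exact: ghom1 | exact: ghom0].
  + by apply: rot_out.
  + by apply: rot_out.
- by apply: rot_section.
- by apply: rot_section.
- apply: ghom_block; [exact: ghom0| |exact: ghom0|exact: ghom0].
  apply: ghom_row; first exact: ghom0.
  by rewrite ghom_taur addNr; apply: ghomN; exact: ghom1.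
- apply: ghom_block; [exact: ghom0| |exact: ghom0|exact: ghom0].
  by apply: ghom_row; [exact: ghom0 | apply: ghomN; exact: ghom1].
- apply: rot_homotopy.
- rewrite [RHS]addrC; apply: rot_homotopy.
Qed.

Section Closure.
Variables (P : T -> Prop) (P_tri : is_trisub P).
Implicit Types X Y Z : mf.

Lemma trisub_cone_of X Y (p : mfmor X Y) : P X -> P Y -> P (cone p).
Proof.
move=> PX PY.
suff tri : exact_tri (t := T) (hclass p : Defs.hom (X : T) Y)
    (hclass (cone_in p) : Defs.hom (Y : T) (cone p))
    (hclass (cone_out p) : Defs.hom (cone p : T) (trans T X)).
  exact: (trisub_cone P_tri tri PX PY).
exists X, Y, p, (idm (X : T)), (idm (Y : T)), (idm (cone p : T)).
split; first by split; apply: (idm_is_iso (C := hmf_cat h f)).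
by rewrite (fmap1 (hmf_T h f)) !cmp1 !cmpr1; split.
Qed.

Lemma trisub_TV X : P (mf_T X) -> P X.
Proof.
move=> /(trisub_itrans P_tri); apply: (trisub_iso P_tri).
have [u [ui _]] := hmf_TK h f; exists (u X); exact: ui.
Qed.

(** Rotation gives the two-out-of-three property of [P]. *)
Lemma trisub_source X Y (p : mfmor X Y) : P Y -> P (cone p) -> P X.
Proof.
move=> PY PC; apply: trisub_TV; apply: (trisub_iso P_tri).
  exact/isomorphic_sym/(cone_cone_in p).
exact: trisub_cone_of.
Qed.

Lemma trisub_target X Y (p : mfmor X Y) : P X -> P (cone p) -> P Y.
Proof.
move=> PX PC; apply: (trisub_source (p := cone_in p)) => //.
apply: (trisub_iso P_tri (cone_cone_in p)); exact: (trisub_trans P_tri PX).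
Qed.

Lemma trisub_tauh X : P X <-> P (mf_tau h X).
Proof.
rewrite -mf_TT; split; last by move=> /trisub_TV/trisub_TV.
by move=> PX; do 2! apply: (trisub_trans P_tri).
Qed.

Lemma trisub_tauhz (k : int) X : P (mf_tau (h%:Z * k) X) <-> P X.
Proof.
case: k => n; elim: n => [|n IH].
- by rewrite mulr0 mf_tau0.
- rewrite -IH [X in _ <-> X]trisub_tauh mf_tauD.
  by rewrite (_ : h%:Z * n + h%:Z = h%:Z * n.+1) //; lia.
- rewrite trisub_tauh mf_tauD (_ : _ + _ = 0) ?mf_tau0 //; lia.
- rewrite trisub_tauh mf_tauD -IH.
  by rewrite (_ : h%:Z * Negz n.+1 + h%:Z = h%:Z * Negz n) //; lia.
Qed.

End Closure.

End Triangles.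

(** * The triangle of a factorization of the first matrix *)

(** The retraction of the cone of [(A, f_1 B) -> X] onto [(B, A f_1)] in block
    form, with [C] for [f_1]. *)
Section FactorBlocks.
Variables (R : comPzRingType) (m n k : nat).
Variables (A : 'M[R]_(k, m)) (B : 'M[R]_(n, k)) (C : 'M[R]_(m, n)).

Lemma factor_in0 : col_mx (- C) 1%:M *m B =
  block_mx (- (C *m B)) 0 B (B *m A) *m col_mx 1%:M 0.
Proof.
rewrite mul_col_mx mul_block_col !mulmx0 mulmx1 mulmx1 mul1mx !addr0.
by rewrite mulNmx.
Qed.

Lemma factor_in1 : col_mx 1%:M 0 *m (A *m C) =
  block_mx (- A) 0 1%:M C *m col_mx (- C) 1%:M.
Proof.
rewrite mul_col_mx mul_block_col !mul0mx mulmx1 !mul1mx addr0 addNr.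
by rewrite mulmxN mulNmx opprK.
Qed.

Lemma factor_out0 : row_mx 0 1%:M *m block_mx (- (C *m B)) 0 B (B *m A) =
  B *m row_mx 1%:M A.
Proof.
by rewrite mul_row_block mul_mx_row mul0mx mulmx0 !mul1mx mulmx1 !add0r.
Qed.

Lemma factor_out1 : row_mx 1%:M A *m block_mx (- A) 0 1%:M C =
  (A *m C) *m row_mx 0 1%:M.
Proof.
by rewrite mul_row_block mul_mx_row !mulmx0 !mulmx1 !mul1mx addNr add0r.
Qed.

Lemma factor_homotopy0 : col_mx 1%:M 0 *m row_mx 1%:M A - 1%:M =
  block_mx (- A) 0 1%:M C *m block_mx 0 (- 1%:M) 0 0.
Proof.
rewrite mul_col_row mulmx_block scalar_mx_block opp_block_mx add_block_mx.
rewrite !mul0mx !mulmx0 !mul1mx !mulmxN !mulmx1.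
by rewrite opprK !(addr0, add0r, subrr, oppr0).
Qed.

Lemma factor_homotopy1 : col_mx (- C) 1%:M *m row_mx 0 1%:M - 1%:M =
  block_mx 0 (- 1%:M) 0 0 *m block_mx (- A) 0 1%:M C.
Proof.
rewrite mul_col_row mulmx_block scalar_mx_block opp_block_mx add_block_mx.
rewrite !mul0mx !mulmx0 !mul1mx !mulmx1 !mulNmx !mul1mx.
by rewrite !(addr0, add0r, subrr, oppr0).
Qed.

End FactorBlocks.

(** If [f_0 = B A] with [A : F_0 -> G] and [B : G -> F_1], then [(A, f_1 B)] and
    [(B, A f_1)] are matrix factorizations, and they form an exact triangle
    [(A, f_1 B) -> X -> (B, A f_1)].  On cokernels this is the exact sequence
    of [coker A], [coker (B A)] and [coker B]. *)
Section Factorisation.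
Variables (K : fieldType) (h : nat) (f : {mpoly K[2]}).
Local Notation S := {mpoly K[2]}.
Local Notation mf := (mf h f).
Local Notation T := (HMF h f).
Variables (X : mf) (G : gfree).
Variables (A : 'M[S]_(rk G, rk (F0 X))) (B : 'M[S]_(rk (F1 X), rk G)).
Hypotheses (A_deg : @ghom K (F0 X) G 0 A) (B_deg : @ghom K G (F1 X) 0 B).
Hypotheses (BA : B *m A = f0 X) (AB : A *m f1 X *m B = f%:M).

Lemma left_factor_deg : @ghom K G (F0 X) h (f1 X *m B).
Proof. by have := ghomM (f1_deg (m := X)) B_deg; rewrite add0r. Qed.
Lemma left_factor_f10 : f1 X *m B *m A = f%:M.
Proof. by rewrite -mulmxA BA f10. Qed.
Lemma left_factor_f01 : A *m (f1 X *m B) = f%:M.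
Proof. by rewrite mulmxA. Qed.
Definition left_factor : mf :=
  MF A_deg left_factor_deg left_factor_f10 left_factor_f01.

Lemma right_factor_deg : @ghom K (F1 X) G h (A *m f1 X).
Proof. by have := ghomM A_deg (f1_deg (m := X)); rewrite addr0. Qed.
Lemma right_factor_f01 : B *m (A *m f1 X) = f%:M.
Proof. by rewrite mulmxA BA f01. Qed.
Definition right_factor : mf :=
  MF B_deg right_factor_deg AB right_factor_f01.

Lemma left_factor_in_subproof : @mfmor_axiom K h f left_factor X (1%:M, B).
Proof.
split=> //=; rewrite ?mulmx1 ?mul1mx //; exact: ghom1.
Qed.
Definition left_factor_in : mfmor left_factor X :=
  mkmor left_factor_in_subproof.

Lemma cone_left_factor_in :
  isomorphic (right_factor : T) (cone left_factor_in).
Proof.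
apply: (isomorphicI (X := right_factor) (Y := cone left_factor_in)
  (a := (col_mx 1%:M 0, col_mx (- f1 X) 1%:M))
  (b := (row_mx 1%:M A, row_mx 0 1%:M))
  (h0 := block_mx 0 (- 1%:M) 0 0) (h1 := 0)).
- split.
  + by apply: ghom_col; [exact: ghom1 | exact: ghom0].
  + apply: ghom_col; last exact: ghom1.
    by rewrite ghom_taur add0r; apply: ghomN; exact: (f1_deg (m := X)).
  + by rewrite /= -BA; apply: factor_in0.
  + by apply: factor_in1.
- split.
  + by apply: ghom_row; [exact: ghom1 | ].
  + by apply: ghom_row; [exact: ghom0 | exact: ghom1].
  + by rewrite /= -BA; apply: factor_out0.
  + by apply: factor_out1.
- by rewrite /= mul_row_col mulmx1 mulmx0 addr0.
- by rewrite /= mul_row_col mulmx1 mul0mx add0r.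
- apply: ghom_block; [exact: ghom0| |exact: ghom0|exact: ghom0].
  by rewrite ghom_taur addNr; apply: ghomN; exact: ghom1.
- exact: ghom0.
- by rewrite mul0mx add0r; apply: factor_homotopy0.
- by rewrite mulmx0 add0r; apply: factor_homotopy1.
Qed.

Variables (P : T -> Prop) (P_tri : is_trisub P).

Lemma trisub_factor_right : P left_factor -> P X -> P right_factor.
Proof.
move=> PL PX; apply: (trisub_iso P_tri (isomorphic_sym cone_left_factor_in)).
exact: trisub_cone_of.
Qed.

Lemma trisub_factor : P left_factor -> P right_factor -> P X.
Proof.
move=> PL PR; apply: (trisub_target P_tri (p := left_factor_in)) => //.
exact: (trisub_iso P_tri cone_left_factor_in).
Qed.

End Factorisation.

(** * Every object is an iterated extension of linear ones *)
Lemma scale_inj (R : idomainType) m n (c : R) (M N : 'M[R]_(m, n)) :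
  c != 0 -> c *: M = c *: N -> M = N.
Proof.
move=> c0 E; apply/matrixP => i j; apply: (mulfI c0).
by have := congr1 (fun M : 'M_(m, n) => M i j) E; rewrite !mxE.
Qed.

(** As [f] is not a zero divisor, the second commutation rule follows from the
    first. *)
Lemma mfmor_axiomI (K : fieldType) h (f : {mpoly K[2]}) (X Y : mf h f)
    (p : mfpair X Y) : f != 0 ->
  @ghom K (F0 X) (F0 Y) 0 p.1 -> @ghom K (F1 X) (F1 Y) 0 p.2 ->
  p.2 *m f0 X = f0 Y *m p.1 -> mfmor_axiom p.
Proof.
move=> fN0 h1 h2 E; split=> //; apply: (scale_inj fN0).
have := congr1 (fun M => f1 Y *m M *m f1 X) E.
rewrite -!mulmxA f01 mul_mx_scalar -scalemxAr => ->.
by rewrite mulmxA f10 mul_scalar_mx.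
Qed.

(** A vector [w] with [w_j = 1] and [M w = l c] says that replacing column [j]
    of [M] by the combination [M w] makes this column divisible by [l].  Then
    [M = colop_l * colop_r], where [colop_l] is [M] with column [j] replaced by
    [c] and [colop_r] is, up to an invertible factor, the diagonal matrix with
    one entry [l] and the others 1. *)
Section ColumnOperation.
Variables (R : idomainType) (m n : nat) (j : 'I_n).
Variables (M : 'M[R]_(m, n)) (l : R) (w : 'cV[R]_n) (c : 'cV[R]_m).
Hypotheses (w1 : w j 0 = 1) (Mw : M *m w = l *: c).
Local Notation E := (delta_mx j j : 'M[R]_n).
Local Notation e := (delta_mx j 0 : 'cV[R]_n).
Local Notation eT := (delta_mx 0 j : 'rV[R]_n).
Local Notation W := (w *m eT).

Definition colop_r : 'M[R]_n := 1%:M - W + l *: E.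
Definition colop_l : 'M[R]_(m, n) := M *m (1%:M - E) + c *m eT.

Lemma colop_eTw : eT *m w = 1%:M.
Proof. by rewrite -rowE; apply/matrixP => i k; rewrite !ord1 !mxE w1. Qed.

Lemma colop_eTe : eT *m e = 1%:M :> 'M[R]_1.
Proof. by rewrite mul_delta_mx; apply/matrixP => i k; rewrite !ord1 !mxE. Qed.

Lemma colop_EE : E = e *m eT.
Proof. by rewrite mul_delta_mx. Qed.

Lemma colop_eT : eT *m colop_r = l *: eT.
Proof.
rewrite /colop_r mulmxDr mulmxBr mulmx1 mulmxA colop_eTw mul1mx subrr add0r.
by rewrite -scalemxAr colop_EE mulmxA colop_eTe mul1mx.
Qed.

Lemma colop_re : (1%:M - E) *m colop_r = 1%:M - W.
Proof.
rewrite mulmxBl mul1mx {1}colop_EE -mulmxA colop_eT -scalemxAr -colop_EE.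
by rewrite addrK.
Qed.

Lemma colop_er : colop_r *m (1%:M - E) = 1%:M - E.
Proof.
have re : colop_r *m e = e - w + l *: e.
  rewrite /colop_r mulmxDl mulmxBl mul1mx -mulmxA colop_eTe mulmx1.
  by rewrite -scalemxAl {1}colop_EE -mulmxA colop_eTe mulmx1.
rewrite mulmxBr mulmx1 {1}colop_EE mulmxA re mulmxDl mulmxBl -scalemxAl.
rewrite -colop_EE.
by rewrite /colop_r opprD addrACA subrr addr0 opprB addrA subrK.
Qed.

Lemma colop_w : colop_r *m w = l *: e.
Proof.
rewrite /colop_r mulmxDl mulmxBl mul1mx -mulmxA colop_eTw mulmx1 subrr add0r.
by rewrite -scalemxAl colop_EE -mulmxA colop_eTw mulmx1.
Qed.

Lemma colopE : colop_l *m colop_r = M.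
Proof.
rewrite /colop_l mulmxDl -!mulmxA colop_re colop_eT mulmxBr mulmx1.
by rewrite mulmxA Mw -scalemxAr -scalemxAl subrK.
Qed.

Lemma colop_rK : colop_r *m (l *: (1%:M - E) + W) = l%:M.
Proof.
rewrite mulmxDr -scalemxAr colop_er mulmxA colop_w -scalemxAl -colop_EE.
by rewrite -scalerDr subrK scalemx1.
Qed.

(** In [N * colop_l * colop_r = d] the factor [colop_r] may be moved to the
    front, because it can be cancelled on the right: by [colop_rK] it divides
    the scalar [l]. *)
Lemma colop_factor (d : R) (N : 'M[R]_(n, m)) : l != 0 -> N *m M = d%:M ->
  colop_r *m N *m colop_l = d%:M.
Proof.
move=> l0 NM; apply: (scale_inj l0).
rewrite -!mul_mx_scalar -colop_rK !mulmxA; congr (_ *m _).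
by rewrite -!mulmxA colopE NM scalar_mxC.
Qed.

Lemma colop_rE k i :
  colop_r k i = if i == j then (if k == j then l else - w k 0) else (k == i)%:R.
Proof.
rewrite !mxE big_ord1 !mxE eqxx /=.
case: (i =P j) => [->|/eqP ij]; last first.
  by rewrite mulr0 andbF mulr0 subr0 addr0.
rewrite andbT mulr1; case: (k =P j) => [->|_].
  by rewrite w1 subrr mulr1 add0r.
by rewrite mulr0 addr0 sub0r.
Qed.

Lemma colop_lE k i : colop_l k i = if i == j then c k 0 else M k i.
Proof.
rewrite /colop_l mulmxBr mulmx1 !mxE big_ord1 !mxE eqxx /=.
rewrite (bigD1 j) //= big1 => [|o oj]; last by rewrite mxE (negbTE oj) mulr0.
rewrite mxE eqxx addr0 /=; case: (i =P j) => [->|_].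
  by rewrite !mulr1 subrr add0r.
by rewrite !mulr0 subr0 addr0.
Qed.

End ColumnOperation.

Section Devissage.
Variables (K : fieldType) (mu : nat) (t : 'I_mu -> K) (s : 'I_mu.+1 -> K).
Variables (ts : is_param t s).
Local Notation S := {mpoly K[2]}.
Local Notation h := mu.+1.
Local Notation F n I := (mf_tau n (rank_one ts I)).
Local Notation mf := (mf h (ftilde t)).
Local Notation T := (HMF h (ftilde t)).
Local Notation lin i := (x_ K + s i *: q_ K).
Local Notation ev i := (meval (pt (- s i) 1)).

Lemma ftilde_linprodT : ftilde t = linprod s setT.
Proof. by rewrite -(linprodC ts set0) linprod0 mulr1 setC0. Qed.

Lemma ftilde_neq0 : ftilde t != 0.
Proof. by rewrite ftilde_linprodT linprod_neq0. Qed.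

Lemma lin_neq0 i : lin i != 0.
Proof. by rewrite -linprod1 linprod_neq0. Qed.

Lemma mf_entry (X : mf) i j :
  homogz (shifts (F1 X) 0 i - shifts (F0 X) 0 j) (f0 X i j).
Proof. by have /ghomP/(_ i j) := f0_deg (m := X); rewrite add0r. Qed.

(** At the point [(1, 0)] the form [f] takes the value 1, so no column of [f_0]
    is zero there. *)
Lemma mf_shift_le (X : mf) M : (forall i, shifts (F1 X) 0 i <= M) ->
  forall j, shifts (F0 X) 0 j <= M.
Proof.
move=> leM j; rewrite leNgt; apply/negP => ltM.
have := congr1 (fun N : 'M_(rk (F0 X)) => (N j j).@[pt 1 0]) (f10 X).
have f_inf : (ftilde t).@[pt 1 0] = 1.
  by rewrite ftilde_linprodT linprod_eval_inf.
rewrite !mxE eqxx mulr1n f_inf big1.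
  by rewrite meval0 => /eqP; rewrite eq_sym oner_eq0.
move=> i _; have hij := mf_entry (X := X) i j.
by rewrite (homogz_lt0 _ hij) ?mulr0 //; have := leM i; lia.
Qed.

(** If [f_0 g] is divisible by [l_i] and [f_0] is injective at the root of
    [l_i], then [g] itself vanishes there, and [l_i] can be taken out of [g];
    start from [g = f_1]. *)
Lemma mf_divide (X : mf) (A : {set 'I_h}) :
  (forall i (v : 'cV[K]_(rk (F0 X))), map_mx (ev i) (f0 X) *m v = 0 -> v = 0) ->
  exists2 g, @ghom K (F1 X) (F0 X) (h%:Z - #|A|%:Z) g &
    f0 X *m g = (linprod s (~: A))%:M.
Proof.
move=> inj; elim/set_ind: A => [|i A iA [g hg gE]].
  exists (f1 X); first by rewrite cards0 subr0; exact: f1_deg.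
  by rewrite f01 setC0 -ftilde_linprodT.
have linA : linprod s (~: A) = lin i * linprod s (~: (i |: A)).
  rewrite -linprodU1 ?inE ?eqxx //; congr linprod; apply/setP => j.
  by rewrite !inE; case: eqP => // ->; rewrite iA.
have g0 k j : (g k j).@[pt (- s i) 1] = 0.
  have E0 : map_mx (ev i) (f0 X) *m col j (map_mx (ev i) g) = 0.
    rewrite colE mulmxA -map_mxM gE linA map_scalar_mx.
    rewrite /= mevalM mevalD mevalZ pt_x pt_q mulr1 addNr mul0r.
    by rewrite -scalemx1 scale0r mul0mx.
  by have /colP/(_ k) := inj i _ E0; rewrite !mxE.
have /ghomP hg' := hg.
have H k j : exists w, homogz (h%:Z - #|A|%:Z + shifts (F0 X) 0 k
    - shifts (F1 X) 0 j - 1) w /\ g k j = lin i * w.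
  by have [w hw wE] := factor_homog (hg' k j) (g0 k j); exists w.
pose g' := \matrix_(k, j) sval (cid (H k j)).
have g'E : g = lin i *: g'.
  by apply/matrixP => k j; rewrite !mxE; case: cid => w [].
exists g'.
  apply/ghomP => k j; rewrite mxE; case: cid => w /= [hw _].
  have -> : #|i |: A|%:Z = #|A|%:Z + 1 by rewrite cardsU1 iA; lia.
  by move: hw; congr homogz; ring.
apply: (scale_inj (lin_neq0 i)); rewrite scalemxAr -g'E gE linA.
by rewrite scale_scalar_mx.
Qed.

Lemma mf_contractible (X : mf) :
  (forall i (v : 'cV[K]_(rk (F0 X))), map_mx (ev i) (f0 X) *m v = 0 -> v = 0) ->
  idm (X : T) = 0.
Proof.
move=> inj; have [g hg gE] := mf_divide setT inj.
rewrite setCT linprod0 in gE.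
have hg0 : @ghom K (F1 X) (F0 X) 0 g by rewrite cardsT card_ord subrr in hg.
apply: (zero_contractible (X := X) (h0 := 0) (h1 := g)) => //.
- exact: ghom0.
- rewrite mulmx0 addr0; apply: (scale_inj ftilde_neq0).
  rewrite scalemx1 -(f10 X) scalemxAl -mul_scalar_mx -(f10 X) -!mulmxA.
  by rewrite (mulmxA (f0 X) g) gE mul1mx.
- by rewrite mul0mx addr0.
Qed.

Variables (P : T -> Prop) (P_tri : is_trisub P).
Hypothesis P_lin : forall n i, P (F n [set i]).

(** When [M] bounds the shifts of [F_1], each summand is nonnegative by
    [mf_shift_le]: this is the termination measure. *)
Definition deficit (M : int) (X : mf) : int :=
  \sum_j (M - shifts (F0 X) 0 j).

(** A kernel vector [v] of [f_0] at [(-s_i, 1)] is made homogeneous by powers of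
    [q], and the resulting column operation factors [f_0] through a free module
    in which a single shift has grown by 1.  The left factor is homotopy
    equivalent to a shift of [F_{i}]. *)
Lemma mf_split_linear (X : mf) i (v : 'cV[K]_(rk (F0 X))) :
  map_mx (ev i) (f0 X) *m v = 0 -> v != 0 ->
  exists2 Y : mf, P Y -> P X & forall M : int,
    (forall k, shifts (F1 X) 0 k <= M) ->
    (forall k, shifts (F1 Y) 0 k <= M) /\ deficit M Y = deficit M X - 1.
Proof.
move=> v0 vN0.
have [j1 vj1] : exists j, v j 0 != 0.
  apply/existsP; apply: contraR vN0 => /existsPn H; apply/eqP/colP => j.
  by rewrite mxE; apply/eqP; have := H j; rewrite negbK.
pose e k : int := shifts (F0 X) 0 k.
pose d k : int := shifts (F1 X) 0 k.
case: (@Order.TotalTheory.arg_minP _ int _ j1 (fun j => v j 0 != 0) e vj1).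
(* The exponents of [q] below are nonnegative because the shift at [j] is
   minimal among those where [v] is not zero. *)
move=> j vj e_min.
pose w : 'cV[S]_(rk (F0 X)) :=
  \col_k (if v k 0 == 0 then 0
          else (v k 0 / v j 0) *: q_ K ^+ absz (e k - e j)%R).
have w_homog k : homogz (e k - e j) (w k 0).
  rewrite mxE; case: eqP => [_|/eqP vk]; first exact: homogz0.
  apply: homogzZ; have := homogzX (absz (e k - e j)%R) (q_homog K).
  by rewrite mul1r gez0_abs // subr_ge0 e_min.
have w_ev k : (w k 0).@[pt (- s i) 1] = v k 0 / v j 0.
  rewrite mxE; case: eqP => [->|_]; first by rewrite meval0 mul0r.
  by rewrite mevalZ rmorphXn /= pt_q expr1n mulr1.
have wj : w j 0 = 1.
  by rewrite mxE (negbTE vj) subrr expr0 divff // scale1r.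
have H k : exists c, homogz (d k - e j - 1) c /\ (f0 X *m w) k 0 = lin i * c.
  have [||c hc cE] := @factor_homog K (s i) (d k - e j) ((f0 X *m w) k 0).
  - rewrite mxE; apply: homogz_sum => l.
    have := homogzM (mf_entry k l) (w_homog l); congr homogz.
    by rewrite /e /d; ring.
  - have /colP/(_ k) := v0; rewrite !mxE => E0.
    rewrite raddf_sum /= (eq_bigr (fun l =>
      map_mx (ev i) (f0 X) k l * v l 0 / v j 0)).
      by rewrite -mulr_suml E0 mul0r.
    by move=> l _; rewrite mevalM w_ev !mxE mulrA.
  by exists c.
pose c : 'cV[S]_(rk (F1 X)) := \col_k sval (cid (H k)).
have c_homog k : homogz (d k - e j - 1) (c k 0).
  by rewrite mxE; case: cid => ? [].
have Mw : f0 X *m w = lin i *: c.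
  by apply/colP => k; rewrite [RHS]mxE [c k 0]mxE; case: cid => c' [].
pose G := @GFree (rk (F0 X)) (shifts (F0 X) + delta_mx 0 j).
have GE k : shifts G 0 k = e k + (k == j)%:Z by rewrite !mxE natz.
pose A : 'M[S]_(rk G, rk (F0 X)) := colop_r j (lin i) w.
pose B : 'M[S]_(rk (F1 X), rk G) := colop_l j (f0 X) c.
have A_deg : @ghom K (F0 X) G 0 A.
  apply/ghomP => k l; rewrite GE colop_rE // -/(e l) add0r.
  case: (l =P j) => [->|/eqP lj].
    case: (k =P j) => [->|_].
      rewrite (_ : e j + true - e j = 1); last by rewrite addrAC subrr.
      by apply: homogzD; [exact: x_homog | apply: homogzZ; exact: q_homog].
    by apply: homogzN; rewrite addr0.
  case: (k =P l) => [->|_]; last exact: homogz0.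
  by rewrite (negbTE lj) addr0 subrr /= dhomog1.
have B_deg : @ghom K G (F1 X) 0 B.
  apply/ghomP => k l; rewrite GE colop_lE -/(d k) add0r.
  case: (l =P j) => [->|_]; last by rewrite addr0; exact: mf_entry.
  by rewrite opprD addrA.
have BA : B *m A = f0 X by exact: colopE.
have AB : A *m f1 X *m B = (ftilde t)%:M.
  by apply: (colop_factor wj Mw (lin_neq0 i)); exact: f10.
exists (right_factor A_deg B_deg BA AB); last first.
  move=> M leM; split=> //; rewrite /deficit.
  rewrite (eq_bigr (fun k => M - e k - (k == j)%:Z)); last first.
    by move=> k _; rewrite /= GE opprD addrA.
  rewrite sumrB; congr (_ - _).
  rewrite (bigD1 j) //= eqxx big1 ?addr0 // => k /negbTE -> //.
move=> PR; apply: (trisub_factor P_tri (A_deg := A_deg) (B_deg := B_deg)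
  (BA := BA) (AB := AB)) => //.
(* The maps [w] and [e_j] embed the linear object in the left factor, and
   the row [e_j^T] projects back. *)
have f0E : f0 (F (e j) [set i]) = (lin i)%:M by rewrite /= linprod1.
apply: (trisub_iso P_tri _ (P_lin (e j) i)).
apply: (isomorphicI (X := F (e j) [set i]) (Y := left_factor A_deg B_deg BA AB)
  (a := (w, delta_mx j 0)) (b := (delta_mx 0 j, delta_mx 0 j))
  (h0 := 0) (h1 := - (1%:M - delta_mx j j))).
- apply: mfmor_axiomI; first exact: ftilde_neq0.
  + apply/ghomP => k l; rewrite ord1; have := w_homog k; congr homogz.
    by rewrite /e /= !mxE; ring.
  + apply/ghomP => k l; rewrite ord1 GE /= !mxE eqxx andbT cards1.
    case: (k =P j) => [->|_]; last exact: homogz0.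
    by rewrite (_ : _ - _ = 0) /= ?dhomog1 //; rewrite /e; ring.
  + by rewrite f0E mul_mx_scalar /= colop_w.
- apply: mfmor_axiomI; first exact: ftilde_neq0.
  + apply/ghomP => k l; rewrite ord1 /= !mxE.
    case: (l =P j) => [->|_]; last exact: homogz0.
    by rewrite (_ : _ - _ = 0) /= ?dhomog1 //; rewrite /e; ring.
  + apply/ghomP => k l; rewrite ord1 GE /= !mxE cards1.
    case: (l =P j) => [->|_]; last exact: homogz0.
    by rewrite (_ : _ - _ = 0) /= ?dhomog1 //; rewrite /e; ring.
  + by rewrite f0E mul_scalar_mx /= colop_eT.
- exact: colop_eTw.
- exact: colop_eTe.
- exact: ghom0.
- apply/ghomP => k l; rewrite GE !mxE; apply: homogzN.
  case: (k =P l) => [->|/eqP kl].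
    case: (l =P j) => [->|_]; first by rewrite subrr; exact: homogz0.
    by rewrite (_ : 0 + _ - _ = 0) /= ?subr0 ?dhomog1 //; rewrite /e /=; ring.
  have -> : (k == j) && (l == j) = false.
    by apply/negP => /andP[/eqP kj /eqP lj]; rewrite kj lj eqxx in kl.
  by rewrite subrr; exact: homogz0.
- by rewrite mulmx0 addr0 mulNmx /= colop_re // opprB.
- by rewrite mul0mx addr0 mulmxN /= colop_er // opprB -colop_EE.
Qed.

Lemma trisub_all (X : mf) : P X.
Proof.
pose M : int := \sum_i `|shifts (F1 X) 0 i|.
have leM i : shifts (F1 X) 0 i <= M.
  rewrite /M (bigD1 i) //=; apply: (le_trans (ler_norm _)).
  by rewrite lerDl sumr_ge0.
suff gen : forall N (Y : mf), (forall i, shifts (F1 Y) 0 i <= M) ->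
    deficit M Y < N%:Z -> P Y.
  by apply: (gen (absz (deficit M X)).+1 X leM); lia.
elim=> [|N IH] Y {}leM defY.
  have : 0 <= deficit M Y.
    by apply: sumr_ge0 => j _; rewrite subr_ge0 mf_shift_le.
  by rewrite leNgt defY.
have [[i [v [v0 vN0]]]|inj] := EM (exists i (v : 'cV[K]_(rk (F0 Y))),
    map_mx (ev i) (f0 Y) *m v = 0 /\ v != 0).
  have [Z PZ /(_ M leM) [leZ defZ]] := mf_split_linear v0 vN0.
  by apply/PZ/IH => //; rewrite defZ; lia.
apply: (trisub_zero P_tri); apply: mf_contractible => i v v0.
by apply/eqP/negPn/negP => vN0; apply: inj; exists i, v.
Qed.

End Devissage.

(** * Generation by the collection *)
Section Generation.
Variables (K : fieldType) (mu : nat) (t : 'I_mu -> K) (s : 'I_mu.+1 -> K).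
Variables (ts : is_param t s).
Local Notation S := {mpoly K[2]}.
Local Notation h := mu.+1.
Local Notation F n I := (mf_tau n (rank_one ts I)).
Local Notation mf := (mf h (ftilde t)).
Local Notation T := (HMF h (ftilde t)).
Local Notation lin i := (x_ K + s i *: q_ K).
Local Notation q := (q_ K).

Lemma scalar_mxD (R : pzRingType) n (a b : R) :
  (a + b)%:M = a%:M + b%:M :> 'M_n.
Proof. exact: raddfD. Qed.

Lemma scalar_mxN (R : pzRingType) n (a : R) : (- a)%:M = - a%:M :> 'M_n.
Proof. exact: raddfN. Qed.

Lemma q_mult_subproof n i :
  @mfmor_axiom K h (ftilde t) (F n [set i]) (F (n + 1) [set i]) (q%:M, q%:M).
Proof.
apply: mfmor_axiomI; first exact: (ftilde_neq0 ts).
- apply/ghomP => k l; rewrite !ord1 /= !mxE eqxx mulr1n.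
  by have := q_homog K; congr homogz; ring.
- apply/ghomP => k l; rewrite !ord1 /= !mxE eqxx mulr1n.
  by have := q_homog K; congr homogz; ring.
- by rewrite /= scalar_mxC.
Qed.
Definition q_mult n i : mfmor (F n [set i]) (F (n + 1) [set i]) :=
  mkmor (q_mult_subproof n i).

(** Multiplication by [q] is injective on [S / l_i] with cokernel
    [S / (l_i, q)], so this object represents the residue field [S / (x, q)],
    for every [i]. *)
Definition koszul n i : mf := cone (q_mult n i).

(** Adding a multiple of [q] to [l_i] turns it into [l_j]; the second entry is
    the correction needed on the complementary factors, where
    [f / l_i - f / l_j = (s_j - s_i) q * f / (l_i l_j)]. *)
Definition koszul_change i j : mfpair (koszul 0 i) (koszul 0 j) :=
  (block_mx 1%:M (- (s j - s i)%:MP)%:M 0 1%:M,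
   block_mx 1%:M ((s j - s i)%:MP * linprod s (~: [set i; j]))%:M 0 1%:M).

Lemma linprod_setC1 i j : i != j ->
  linprod s (~: [set i]) = lin j * linprod s (~: [set i; j]).
Proof.
move=> ij; rewrite -linprodU1 ?inE ?eqxx ?orbT //; congr linprod.
apply/setP => k; rewrite !inE negb_or.
by case: (k =P j) => [->|_]; rewrite ?andbT // eq_sym ij.
Qed.

Lemma koszul_change_axiom n i j : i != j ->
  @mfmor_axiom K h (ftilde t) (koszul n i) (koszul n j) (koszul_change i j).
Proof.
move=> ij; apply: mfmor_axiomI; first exact: (ftilde_neq0 ts).
- apply: ghom_block; [ | | exact: ghom0 | exact: ghom1].
    apply/ghomP => k l; rewrite !ord1 /= !mxE !cards1.
    by rewrite (_ : _ - _ = 0) /= ?dhomog1 //; ring.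
  apply/ghomP => k l; rewrite !ord1 /= !mxE eqxx mulr1n !cards1.
  apply: homogzN; rewrite (_ : _ - _ = 0); last by ring.
  by rewrite -alg_mpolyC; apply: homogzZ; rewrite /= dhomog1.
- apply: ghom_block; [exact: ghom1 | | exact: ghom0 | ].
    apply/ghomP => k l; rewrite !ord1 /= !mxE eqxx mulr1n !cards1.
    have hm : (#|~: [set i; j]| + 2 = h)%N.
      by have := cardsC [set i; j]; rewrite cards2 ij card_ord addnC.
    rewrite mul_mpolyC; apply: homogzZ.
    have := linprod_homogz s (~: [set i; j]); congr homogz.
    have -> : h%:Z = #|~: [set i; j]|%:Z + 2 by lia.
    by ring.
  apply/ghomP => k l; rewrite !ord1 /= !mxE !cards1.
  by rewrite (_ : _ - _ = 0) /= ?dhomog1 //; ring.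
have ji : j != i by rewrite eq_sym.
rewrite /= !mulmx_block !mul1mx !mulmx1 !mul0mx !mulmx0 !addr0 !add0r.
rewrite (linprod_setC1 ij) (linprod_setC1 ji) (setUC [set j]) !linprod1.
rewrite -!scalar_mxM -!scalar_mxN -!scalar_mxM -!scalar_mxD.
congr block_mx; congr scalar_mx;
  rewrite -!mul_mpolyC ?mpolyCN ?mpolyCB; ring.
Qed.

Lemma koszul_indep n i j : i != j ->
  isomorphic (koszul n i : T) (koszul n j).
Proof.
move=> ij; have ji : j != i by rewrite eq_sym.
have cancel i' j' (a := koszul_change i' j') (b := koszul_change j' i') :
    b.1 *m a.1 = 1%:M /\ b.2 *m a.2 = 1%:M.
  rewrite /= !mulmx_block !mul1mx !mulmx1 !mul0mx !mulmx0 !addr0 !add0r.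
  rewrite (setUC [set j']) -!scalar_mxD -!mulrDl -!opprD -!mpolyCD addrA subrK.
  by rewrite subrr mpolyC0 mul0r oppr0 raddf0 -scalar_mx_block.
have [ba1 ba2] := cancel i j; have [ab1 ab2] := cancel j i.
exact: (isomorphic_strict (koszul_change_axiom n ij) (koszul_change_axiom n ji)
  ba1 ba2 ab1 ab2).
Qed.

Variables (a : 'I_mu -> 'I_mu.+1) (a_inj : injective a).
Variables (P : T -> Prop) (P_tri : is_trisub P).

Lemma trisub_rank_one0 n : P (F n set0).
Proof.
apply: (trisub_zero P_tri).
apply: (zero_contractible (X := F n set0) (h0 := 0) (h1 := 1%:M)).
- exact: ghom0.
- apply/ghomP => i j; rewrite !ord1 /= !mxE cards0 (_ : _ - _ = 0);
    rewrite /= ?dhomog1 //; by ring.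
- by rewrite mulmx0 addr0 mul1mx /= linprod0.
- by rewrite mul0mx addr0 mulmx1 /= linprod0.
Qed.

Lemma trisub_rank_oneT n : P (F n setT).
Proof.
apply: (trisub_zero P_tri).
apply: (zero_contractible (X := F n setT) (h0 := 1%:M) (h1 := 0)).
- apply/ghomP => i j; rewrite !ord1 /= !mxE cardsT card_ord (_ : _ - _ = 0);
    rewrite /= ?dhomog1 //; by ring.
- exact: ghom0.
- by rewrite mul0mx add0r mulmx1 /= setCT linprod0.
- by rewrite mulmx0 add0r mul1mx /= setCT linprod0.
Qed.

(** The triangle of the factorization [f_(J + i) = l_i * f_J]. *)
Lemma trisub_step n (J : {set 'I_h}) i : i \notin J ->
  P (F n J) -> P (F n (i |: J)) -> P (F (n + #|J|%:Z) [set i]).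
Proof.
move=> iJ PJ PiJ.
pose X := F n (i |: J); pose G := F1 (F n J).
pose A : 'M[S]_(rk G, rk (F0 X)) := (linprod s J)%:M.
pose B : 'M[S]_(rk (F1 X), rk G) := (linprod s [set i])%:M.
have A_deg : @ghom K (F0 X) G 0 A by exact: (f0_deg (m := F n J)).
have B_deg : @ghom K G (F1 X) 0 B.
  apply/ghomP => k l; rewrite !ord1 /= !mxE eqxx mulr1n.
  have := linprod_homogz s [set i]; congr homogz.
  have -> : #|i |: J|%:Z = #|J|%:Z + 1 by rewrite cardsU1 iJ; lia.
  by rewrite cards1; ring.
have BA : B *m A = f0 X.
  by rewrite -scalar_mxM linprod1 -linprodU1.
have JC : linprod s (~: J) = linprod s [set i] * linprod s (~: (i |: J)).
  rewrite linprod1 -linprodU1 ?inE ?eqxx //; congr linprod.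
  by apply/setP => k; rewrite !inE; case: eqP => // ->; rewrite iJ.
have iC : linprod s (~: [set i]) = linprod s J * linprod s (~: (i |: J)).
  rewrite -linprodU; last by rewrite disjoints_subset setCK subsetUr.
  congr linprod; apply/setP => k; rewrite !inE negb_or.
  case: eqP => [->|_] /=; first by rewrite (negbTE iJ).
  by rewrite orbN.
have AB : A *m f1 X *m B = (ftilde t)%:M.
  by rewrite -!scalar_mxM -(linprodC ts J) JC; congr (_%:M); ring.
have <- : right_factor A_deg B_deg BA AB = F (n + #|J|%:Z) [set i].
  apply: MF_congr.
  - by apply/rowP => k; rewrite !mxE; ring.
  - apply/rowP => k; rewrite !mxE cards1.
    have -> : #|i |: J|%:Z = #|J|%:Z + 1 by rewrite cardsU1 iJ; lia.
    by ring.
  - by [].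
  - by rewrite /= -scalar_mxM iC.
apply: (trisub_factor_right P_tri) => //.
have -> // : left_factor A_deg B_deg BA AB = F n J.
apply: MF_congr => //.
by rewrite /= -scalar_mxM JC mulrC.
Qed.

Hypothesis P_gen : forall (e : bool) k, P (F e%:Z (index_set a k)).

Definition initial_set (m : nat) : {set 'I_h} :=
  [set a j | j : 'I_mu & (j < m)%N].

Lemma initial_set0 : initial_set 0 = set0.
Proof.
apply/setP => i; rewrite in_set0; apply/negbTE/imsetP => -[j].
by rewrite inE.
Qed.

Lemma trisub_initial_set (e : bool) m :
  (m <= mu)%N -> P (F e%:Z (initial_set m)).
Proof.
case: m => [_|m hm].
  rewrite initial_set0; exact: trisub_rank_one0.
exact: (P_gen e (Ordinal hm)).
Qed.

Lemma card_initial_set m : (m <= mu)%N -> #|initial_set m| = m.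
Proof.
case: m => [_|m hm]; last exact: (card_index_set a_inj (Ordinal hm)).
by rewrite initial_set0 cards0.
Qed.

(** The parameter [k] is the size of the set that precedes the one where [i]
    enters the chain. *)
Definition at_level (k : nat) (i : 'I_h) : Prop :=
  (k < h)%N /\ forall e : bool, P (F (k%:Z + e%:Z) [set i]).

Lemma at_level_in (j : 'I_mu) : at_level j (a j).
Proof.
split; first by rewrite ltnS ltnW.
have jmu : (j <= mu)%N by exact: ltnW.
move=> e; rewrite addrC -{1}(card_initial_set jmu); apply: trisub_step.
- by apply/imsetP => -[k]; rewrite inE => kj /a_inj jk; rewrite jk ltnn in kj.
- exact: trisub_initial_set.
rewrite (_ : a j |: initial_set j = index_set a j) //.
apply/setP => i; rewrite !inE; apply/orP/imsetP => [[/eqP->|/imsetP[k]]|[k]].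
- by exists j; rewrite ?inE.
- by rewrite inE => /ltnW kj ->; exists k; rewrite ?inE.
rewrite inE leq_eqVlt => /orP[/eqP/val_inj -> ->|kj ->]; first by left.
by right; apply/imsetP; exists k; rewrite ?inE.
Qed.

(** The one index that is not a value of [a] completes [I_mu] to the full set,
    whose object is zero. *)
Lemma at_level_out i : (forall j, a j != i) -> at_level mu i.
Proof.
move=> ai; split=> // e; rewrite addrC.
have -> : mu%:Z = #|initial_set mu|%:Z by rewrite card_initial_set.
have ipre : i \notin initial_set mu.
  by apply/imsetP => -[j _ ij]; have := ai j; rewrite ij eqxx.
apply: trisub_step => //; first exact: trisub_initial_set.
rewrite (_ : i |: _ = setT); first exact: trisub_rank_oneT.
apply/eqP; rewrite eqEcard subsetT /= cardsT card_ord cardsU1 ipre.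
by rewrite card_initial_set.
Qed.

Lemma level_of i : exists k, at_level k i.
Proof.
have [[j <-]|H] := EM (exists j, a j = i).
  by exists j; exact: at_level_in.
by exists mu; apply: at_level_out => j; apply/eqP => ij; apply: H; exists j.
Qed.

Lemma level_nonempty (k : 'I_h) : exists i, at_level k i.
Proof.
have [kmu|muk] := ltnP k mu.
  by exists (a (Ordinal kmu)); exact: (at_level_in (Ordinal kmu)).
have -> : k = mu :> nat by have := ltn_ord k; lia.
have : (exists i, i \in ~: initial_set mu).
  apply/set0Pn; rewrite -card_gt0.
  by have := cardsC (initial_set mu); rewrite card_ord card_initial_set //; lia.
case=> i; rewrite inE => /imsetP ni; exists i; apply: at_level_out => j.
by apply/eqP => ji; apply: ni; exists j; rewrite ?inE.
Qed.

Lemma trisub_shift m n I :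
  (exists k, m = n + h%:Z * k) -> P (F n I) -> P (F m I).
Proof. by move=> [k ->] PF; rewrite -mf_tauD trisub_tauhz. Qed.

(** Some index [j] sits at the level of [n] modulo [h]; the object obtained
    from [j] is the same for all indices. *)
Lemma trisub_koszul n i : P (koszul n i).
Proof.
have hn : 0 <= modz n h < h%:Z by rewrite modz_ge0 // ltz_pmod.
have kh : (absz (modz n h) < h)%N by lia.
have [j [_ Pj]] := level_nonempty (Ordinal kh).
have Pn (e : bool) : P (F (n + e%:Z) [set j]).
  apply: trisub_shift (Pj e); exists (divz n h).
  by rewrite /= {1}(divz_eq n h) gez0_abs; [ring | case/andP: hn].
have Pj' : P (koszul n j).
  apply: (trisub_cone_of P_tri).
    by have := Pn false; rewrite addr0.
  exact: (Pn true).
have [->//|ji] := eqVneq i j.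
by apply: (trisub_iso P_tri (koszul_indep n _)) Pj'; rewrite eq_sym.
Qed.

Lemma trisub_linear n i : P (F n [set i]).
Proof.
have [k [_ /(_ false)]] := level_of i; rewrite addr0 => Pk.
have up m : P (F m [set i]) -> P (F (m + 1) [set i]).
  by move=> Pm; apply: (trisub_target P_tri Pm (trisub_koszul m i)).
have down m : P (F (m + 1) [set i]) -> P (F m [set i]).
  by move=> Pm; apply: (trisub_source P_tri Pm (trisub_koszul m i)).
have upn m (d : nat) : P (F m [set i]) -> P (F (m + d%:Z) [set i]).
  elim: d => [|d IH]; first by rewrite addr0.
  by move=> /IH/up; rewrite -addrA (_ : d%:Z + 1 = d.+1%:Z) //; lia.
have downn m (d : nat) : P (F m [set i]) -> P (F (m - d%:Z) [set i]).
  elim: d => [|d IH]; first by rewrite subr0.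
  move=> /IH Pm; apply: down; rewrite (_ : _ + 1 = m - d%:Z) //; lia.
have [kn|nk] := leP k%:Z n.
  have -> : n = k%:Z + (absz (n - k%:Z)%R)%:Z by lia.
  exact: upn.
have -> : n = k%:Z - (absz (n - k%:Z)%R)%:Z by lia.
exact: downn.
Qed.

End Generation.

(** * Fullness of the collection *)
Lemma inclusion_equivalence (K : fieldType) (C : lincat K) (P : C -> Prop) :
  (forall X, P X) -> is_equivalence (inclusion P).
Proof.
move=> allP.
pose G := @Functor K C (fullsub P) (fun X => exist P X (allP X))
  (fun X Y u => u) (fun _ _ _ _ _ => erefl) (fun _ => erefl)
  (fun _ _ _ _ _ => erefl).
exists G; split.
  exists (fun X : fullsub P => idm (sval X)); split=> [X|X Y u] /=.
    by exists (idm (sval X)); split; exact: cmp1.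
  by rewrite cmp1 cmpr1.
exists (fun X : C => idm X); split=> [X|X Y u] /=; first exact: idm_is_iso.
by rewrite cmp1 cmpr1.
Qed.

Lemma collection_full (K : fieldType) mu (t : 'I_mu -> K) s (ts : is_param t s)
  (a : 'I_mu -> 'I_mu.+1) :
  injective a -> full_collection (collection ts a).
Proof.
move=> a_inj; set C := HMF _ _.
have gen (X : C) : generated (collection ts a) X.
  move=> P P_tri P_coll; apply: (trisub_all (ts := ts) P_tri) => n i.
  apply: (trisub_linear (ts := ts) a_inj P_tri) => e k.
  have [j <-] : exists j, collection ts a j
      = mf_tau e%:Z (rank_one ts (index_set a k)).
    case: e.
      by exists (rshift mu k); rewrite /collection (unsplitK (inr k)).
    by exists (lshift mu k); rewrite /collection (unsplitK (inl k)) mf_tau0.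
  exact: P_coll.
exact: inclusion_equivalence.
Qed.

Theorem theorem4p11 (R : realType) (mu : nat) (mu_ge1 : (1 <= mu)%N)
    (t : 'I_mu -> R[i]) (s : 'I_mu.+1 -> R[i])
    (ts : is_param t s) (s_generic : injective s)
    (a : 'I_mu -> 'I_mu.+1) (a_inj : injective a) :
  strongly_exceptional (collection ts a) /\ full_collection (collection ts a).
Proof.
split; first exact: collection_strongly_exceptional.
exact: collection_full.
Qed.
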